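(* For $\varepsilon>0$ and $\mu\in\mathcal{P}(\mathbb{T}_{\mathbb{G}})$, let $$\mu_\varepsilon(x):=\Big\langle\mu,\sum_{k\in\mathbb{Z}^n}\psi_\varepsilon\big(k\circ x\circ(\cdot)^{-1}\big)\Big\rangle=\int_{[0,1)^n}\sum_{k\in\mathbb{Z}^n}\psi_\varepsilon\big(k\circ x\circ y^{-1}\big)\,d\mu(y),\quad x\in\mathbb{T}_{\mathbb{G}},$$ where $\psi_\varepsilon$ is the mollifier defined in the context. Then $\mu_\varepsilon\to\mu$ in $\mathcal{P}(\mathbb{T}_{\mathbb{G}})$ as $\varepsilon\to0$ (where $\mu_\varepsilon$ is identified with the measure with density $\mu_\varepsilon$).
   Context: Carnot group. $\mathbb{G}=(\mathbb{R}^n,\circ,D_\lambda)$ is a homogeneous Carnot group of step $r>1$: $\circ$ is a Lie group law on $\mathbb{R}^n$ (identity $0$, inverse $x^{-1}$), $\mathbb{R}^n=\mathbb{R}^{n_1}\times\cdots\times\mathbb{R}^{n_r}$ with $n_1<n$, and for each $\lambda>0$ the dilation $D_\lambda(x^{(1)},\dots,x^{(r)})=(\lambda x^{(1)},\lambda^2x^{(2)},\dots,\lambda^r x^{(r)})$, $x^{(i)}\in\mathbb{R}^{n_i}$, is a group automorphism. The homogeneous dimension is $Q=\sum_{j=1}^r jn_j$. $\mathcal{X}=\{X_1,\dots,X_{n_1}\}$ are the left-invariant vector fields with $X_k(0)=\partial_{x_k}|_0$, and they satisfy $\operatorname{rank}(\operatorname{Lie}\{X_1,\dots,X_{n_1}\}(x))=n$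 for all $x$. Distance. $d_{cc}(x,y)$ is the infimum of $\delta>0$ for which there is an absolutely continuous $\gamma:[0,\delta]\to\mathbb{R}^n$ with $\gamma(0)=x$, $\gamma(\delta)=y$, $\gamma'(t)=\sum_{i=1}^{n_1}a_i(t)X_i(\gamma(t))$ and $\sum_i a_i(t)^2\leq1$ for a.e. $t$. Carnot torus. $\mathbb{Z}^n$ is a subgroup of $(\mathbb{R}^n,\circ)$, and $\mathbb{T}_{\mathbb{G}}=\mathbb{G}/\mathbb{Z}^n$ is the quotient by the relation $x\sim y$ iff $k\circ x=y$ for some $k\in\mathbb{Z}^n$; it is identified as a set with the cube $[0,1)^n$, with Lebesgue measure. It carries the distance $d_{cc}^{\mathbb{T}_{\mathbb{G}}}(x,y)=\inf_{x'\sim x,\,y'\sim y}d_{cc}(x',y')$. Measures. $\mathcal{P}(\mathbb{T}_{\mathbb{G}})$ is the set of Borel probability measures on $\mathbb{T}_{\mathbb{G}}$, endowed with the Kantorovich-Rubinstein distance $d_1(m,m')=\sup\int_{\mathbb{T}_{\mathbb{G}}}\phi\,d(m-m')$, the supremum being over all $\phi:\mathbb{T}_{\mathbb{G}}\to\mathbb{R}$ which are Lipschitz with constant at most $1$ with respect to $d_{cc}^{\mathbb{T}_{\mathbb{G}}}$. Mollifier. Let $\|x\|_{\mathbb{G}}=\big(\sum_{j=1}^r|x^{(j)}|^{\frac{2r!}{j}}\big)^{\frac1{2r!}}$, where $2r!=2\cdot(r!)$ and $|x^{(j)}|$ is the Euclidean norm on $\mathbb{R}^{n_j}$. Let $\psi(x)=\exp\big(\frac1{\|x\|_{\mathbb{G}}^{2r!}-1}\big)$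 if $\|x\|_{\mathbb{G}}<1$ and $\psi(x)=0$ otherwise, and $\psi_\varepsilon(x)=\frac{C}{\varepsilon^Q}\psi(D_{1/\varepsilon}(x))$, where $C>0$ (independent of $\varepsilon$) is such that $\int_{\mathbb{R}^n}\psi_\varepsilon(x)dx=1$. *)

(* Defs.v *)
From HB Require Import structures.
From mathcomp Require Import all_boot all_order all_algebra.
From mathcomp Require Import all_classical all_reals all_analysis.
From mathcomp Require Import measurable_realfun.

Set Implicit Arguments.
Unset Strict Implicit.
Unset Printing Implicit Defensive.

Import Order.TTheory GRing.Theory Num.Theory numFieldNormedType.Exports.

Local Open Scope classical_set_scope.
Local Open Scope ring_scope.

Definition borel_rV (R : realType) (n : nat) :=
  g_sigma_algebraType (@open 'rV[R]_n).

Section lebesgue_rV.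
Context {R : realType}.

Lemma measurable_open_rV n (U : set 'rV[R]_n) :
  open U -> measurable (U : set (borel_rV R n)).
Proof. by move=> oU; exact: sub_sigma_algebra. Qed.

Lemma measurable_coord n (i : 'I_n) :
  measurable_fun setT (fun x : borel_rV R n => (x : 'rV[R]_n) 0 i).
Proof.
apply: (measurability _ (RGenOpens.measurableE R)).
move=> _ [_ [a [b ->]] <-]; rewrite setTI; apply: measurable_open_rV.
have /continuousP := @coord_continuous R 1 n 0 i; apply.
exact: interval_open.
Qed.

Lemma measurable_fun_rV d (T : measurableType d) n (f : T -> borel_rV R n) :
  (forall i, measurable_fun setT (fun t => (f t : 'rV[R]_n) 0 i)) ->
  measurable_fun setT f.
Proof.
move=> mf; apply: (measurability _ (erefl : @measurable _ (borel_rV R n) =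
  <<s @open 'rV[R]_n >>)).
move=> _ [U oU <-]; rewrite setTI.
pose box (p : 'rV[rat]_n * nat) : set 'rV[R]_n :=
  [set x | forall i, `|x 0 i - ratr (p.1 0 i)| < p.2.+1%:R^-1].
have mbox p : measurable (f @^-1` box p).
  rewrite (_ : _ @^-1` _ = \bigcap_(i in [set: 'I_n]) ((fun t => (f t : 'rV[R]_n) 0 i)
      @^-1` [set y | `|y - ratr (p.1 0 i)| < p.2.+1%:R^-1])); last first.
    by apply/seteqP; split => [t ft i _|t ft i]; [exact: ft|exact: (ft i)].
  apply: fin_bigcap_measurable => // i _.
  rewrite -[X in measurable X]setTI; apply: mf => //.
  rewrite (_ : [set y | _] = `]ratr (p.1 0 i) - p.2.+1%:R^-1,
      (ratr (p.1 0 i) + p.2.+1%:R^-1)%R[%classic); first exact: measurable_itv.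
  by apply/seteqP; split => y; rewrite /= in_itv /= ltr_distl.
rewrite (_ : f @^-1` U = \bigcup_(p : 'rV[rat]_n * nat)
    (if `[< box p `<=` U >] then f @^-1` box p else set0)).
  apply: countable_bigcupT_measurable => [|p]; first exact: countableP.
  by case: ifP => // _; exact: measurable0.
apply/seteqP; split => [t Uft|t [p _]]; last first.
  by case: asboolP => // pU /pU.
have := oU; rewrite openE => /(_ _ Uft) /nbhs_ballP [e /= e0 eU].
have [k ke] : exists k, k.+1%:R^-1 < e / 2.
  near \oo%classic => k; exists k; near: k.
  exact: (near_infty_natSinv_lt (PosNum (divr_gt0 e0 (ltr0Sn _ 1)))).
have k0 : 0 < k.+1%:R^-1 :> R by rewrite invr_gt0.
have qP i : exists q : rat, `|(f t : 'rV[R]_n) 0 i - ratr q| < k.+1%:R^-1.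
  have [q] : exists q : rat, ratr q \in
      `](f t : 'rV[R]_n) 0 i - k.+1%:R^-1, (f t : 'rV[R]_n) 0 i + k.+1%:R^-1[.
    by apply: rat_in_itvoo; rewrite ltrBlDr -addrA ltrDl addr_gt0.
  by rewrite in_itv /= -ltr_distlC => ?; exists q.
pose p : 'rV[rat]_n * nat := (\row_i sval (cid (qP i)), k).
have ftp : box p (f t) by move=> i; rewrite mxE; exact: svalP (cid (qP i)).
exists p => //; case: asboolP => [_ //|]; case => y yp; apply: eU.
split => // i j; rewrite ord1 /ball /=.
rewrite (le_lt_trans (ler_distD (ratr (p.1 0 j)) _ _))//.
rewrite (splitr e) ltrD//; first exact: lt_trans (ftp j) ke.
by rewrite distrC; exact: lt_trans (yp j) ke.
Unshelve. all: by end_near. Qed.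

Definition cons_rV n (p : measurableTypeR R * borel_rV R n) : borel_rV R n.+1 :=
  row_mx (p.1%:M : 'rV_1) (p.2 : 'rV_n).

Definition uncons_rV n (x : borel_rV R n.+1) : measurableTypeR R * borel_rV R n :=
  ((x : 'rV_(1 + n)) 0 0, rsubmx (x : 'rV_(1 + n))).

Lemma cons_rVK n : cancel (@cons_rV n) (@uncons_rV n).
Proof.
move=> [a y]; rewrite /uncons_rV /cons_rV /= row_mxKr.
rewrite (_ : 0 = lshift n (0 : 'I_1)); last exact/val_inj.
by rewrite row_mxEl mxE eqxx.
Qed.

Lemma measurable_cons_rV n : measurable_fun setT (@cons_rV n).
Proof.
apply: measurable_fun_rV => i; case: (splitP (i : 'I_(1 + n))) => j ij.
  rewrite [X in measurable_fun _ X](_ : _ = fst); first exact: measurable_fst.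
  apply/funext => -[a y] /=.
  rewrite (_ : i = lshift n j :> 'I_(1 + n)); last exact/val_inj.
  by apply: etrans (row_mxEl _ _ _ _) _; rewrite mxE ord1 eqxx.
rewrite [X in measurable_fun _ X](_ : _ =
    (fun x : borel_rV R n => (x : 'rV[R]_n) 0 j) \o snd); last first.
  apply/funext => -[a y] /=.
  rewrite (_ : i = rshift 1 j :> 'I_(1 + n)); last exact/val_inj.
  exact: row_mxEr.
exact: (measurableT_comp (measurable_coord j) measurable_snd).
Qed.

Lemma measurable_uncons_rV n : measurable_fun setT (@uncons_rV n).
Proof.
apply: measurable_fun_pair; first exact: measurable_coord.
apply: measurable_fun_rV => i; under eq_fun do rewrite mxE.
exact: (@measurable_coord n.+1 (rshift 1 i)).
Qed.

Section lebesgue_cons.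
Variable n : nat.
Variable m : {sigma_finite_measure set (borel_rV R n) -> \bar R}.

(* The library has no Lebesgue measure on R^n: it is built by iterated products. *)
Definition lebesgue_cons : set (borel_rV R n.+1) -> \bar R :=
  pushforward (lebesgue_measure \x m)%E (@cons_rV n).

Let lebesgue_cons0 : lebesgue_cons set0 = 0%E.
Proof. by rewrite /lebesgue_cons /pushforward preimage_set0 measure0. Qed.

Let lebesgue_cons_ge0 A : (0 <= lebesgue_cons A)%E.
Proof. exact: (measure_ge0 (lebesgue_measure \x m)%E). Qed.

Let lebesgue_cons_sigma_additive : semi_sigma_additive lebesgue_cons.
Proof.
have mcons := @measurable_cons_rV n.
exact: (@measure_semi_sigma_additive _ _ _
  (pushforward (lebesgue_measure \x m)%E (@cons_rV n))).
Qed.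

HB.instance Definition _ := isMeasure.Build _ _ _ lebesgue_cons
  lebesgue_cons0 lebesgue_cons_ge0 lebesgue_cons_sigma_additive.

Let lebesgue_cons_sigma_finite : sigma_finite setT lebesgue_cons.
Proof.
have /sigma_finiteP[F [FT ndF Foo]] := sigma_finiteT (@lebesgue_measure R).
have /sigma_finiteP[G [GT ndG Goo]] := sigma_finiteT m.
exists (fun k => @uncons_rV n @^-1` (F k `*` G k)).
  rewrite -preimage_bigcup -[LHS](preimage_setT (@uncons_rV n)); congr (_ @^-1` _).
  rewrite -setXTT FT GT predeqE => -[x y]; split.
    move=> [/= [i _ Fx] [j _ Gy]]; exists (maxn i j) => //; split => /=.
    - by move: x Fx; exact/subsetPset/ndF/leq_maxl.
    - by move: y Gy; exact/subsetPset/ndG/leq_maxr.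
  by move=> [i _ []/= ? ?]; split; exists i.
move=> k; have [mF Fk] := Foo k; have [mG Gk] := Goo k.
have mFG : measurable (F k `*` G k) by exact: measurableX.
split; first by rewrite -[X in measurable X]setTI; exact: measurable_uncons_rV.
rewrite /lebesgue_cons /pushforward -comp_preimage.
rewrite (_ : @uncons_rV n \o @cons_rV n = id).
  by rewrite preimage_id product_measure1E// lte_mul_pinfty// ge0_fin_numE.
by apply/funext => x /=; rewrite cons_rVK.
Qed.

HB.instance Definition _ := Measure_isSigmaFinite.Build _ _ _ lebesgue_cons
  lebesgue_cons_sigma_finite.

End lebesgue_cons.

Fixpoint lebesgue_rV n : {sigma_finite_measure set (borel_rV R n) -> \bar R} :=
  match n with
  | 0 => @dirac _ (borel_rV R 0) (0 : 'rV[R]_0) R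
  | n'.+1 => lebesgue_cons (lebesgue_rV n')
  end.

End lebesgue_rV.
Arguments lebesgue_rV : clear implicits.

Section analysis.
Context {R : realType}.

(* In finite dimension, continuity of all iterated directional derivatives of
   order at most [k] is the usual [C^k] regularity. *)
Fixpoint Ck {V W : normedModType R} (k : nat) (f : V -> W) : Prop :=
  continuous f /\
  match k with
  | 0 => True
  | k'.+1 => forall v, (forall x, derivable f x v) /\ Ck k' (fun x => 'D_v f x)
  end.

Definition smooth {V W : normedModType R} (f : V -> W) := forall k, Ck k f.

Definition absolutely_continuous_on {V : normedModType R} (a b : R)
    (f : R -> V) :=
  forall e : R, 0 < e -> exists2 d : R, 0 < d &
    forall (m : nat) (u v : 'I_m -> R),
      (forall i, a <= u i /\ u i <= v i /\ v i <= b) ->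
      trivIset setT (fun i => `]u i, v i[%classic) ->
      \sum_(i < m) (v i - u i) < d ->
      \sum_(i < m) `|f (v i) - f (u i)| < e.

Definition lie_bracket {n} (Y Z : 'rV[R]_n -> 'rV[R]_n) : 'rV[R]_n -> 'rV[R]_n :=
  fun x => 'D_(Y x) Z x - 'D_(Z x) Y x.

Inductive Lie {n} {I : Type} (X : I -> 'rV[R]_n -> 'rV[R]_n) :
    ('rV[R]_n -> 'rV[R]_n) -> Prop :=
  | Lie_gen i : Lie X (X i)
  | Lie_zero : Lie X (fun=> 0)
  | Lie_lin (a : R) Y Z : Lie X Y -> Lie X Z -> Lie X (fun x => a *: Y x + Z x)
  | Lie_bracket Y Z : Lie X Y -> Lie X Z -> Lie X (lie_bracket Y Z).

End analysis.

(* Layers are numbered from 0: [submxrow x j] is x^(j+1), [ns j] is n_(j+1), and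
   the weight of this layer is [j.+1]. *)
Notation layers_rV R ns := 'rV[R]_(\sum_j ns j).

Definition first_layer (r : nat) (hr : (1 < r)%N) : 'I_r := Ordinal (ltnW hr).

Section homogeneous.
Context {R : realType} {r : nat} {ns : 'I_r -> nat}.
Implicit Type x : layers_rV R ns.

Definition dilation (lambda : R) x : layers_rV R ns :=
  \mxrow_(j < r) (lambda ^+ j.+1 *: submxrow x j).

Definition hom_dim : nat := (\sum_(j < r) j.+1 * ns j)%N.

Definition euclidean_norm {m} (v : 'rV[R]_m) : R :=
  Num.sqrt (\sum_i v 0 i ^+ 2).

Definition hom_norm x : R :=
  (\sum_(j < r) euclidean_norm (submxrow x j) `^ ((2 * r`!)%:R / j.+1%:R))
    `^ (2 * r`!)%:R^-1.

Definition bump_psi x : R :=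
  if hom_norm x < 1 then expR ((hom_norm x ^+ (2 * r`!) - 1)^-1) else 0.

Definition mollifier (C eps : R) x : R :=
  C / eps ^+ hom_dim * bump_psi (dilation eps^-1 x).

End homogeneous.

Definition int_rV {R : realType} {n} (k : 'rV[int]_n) : 'rV[R]_n :=
  map_mx (fun z : int => z%:~R) k.

Record carnotGroup (R : realType) (r : nat) (hr : (1 < r)%N)
    (ns : 'I_r -> nat) := CarnotGroup {
  carnot_op : layers_rV R ns -> layers_rV R ns -> layers_rV R ns;
  carnot_inv : layers_rV R ns -> layers_rV R ns;
  carnot_opA : associative carnot_op;
  carnot_op0x : left_id 0 carnot_op;
  carnot_opx0 : right_id 0 carnot_op;
  carnot_opVx : left_inverse 0 carnot_inv carnot_op;
  carnot_opxV : right_inverse 0 carnot_inv carnot_op;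
  carnot_op_smooth : smooth (fun p : layers_rV R ns * layers_rV R ns => carnot_op p.1 p.2);
  carnot_inv_smooth : smooth carnot_inv;
  carnot_layers_gt0 : forall j, (0 < ns j)%N;
  carnot_first_layer_lt : (ns (first_layer hr) < \sum_j ns j)%N;
  carnot_dilationM : forall lambda, 0 < lambda ->
    {morph dilation lambda : x y / carnot_op x y};
  (* X_1, ..., X_{n_1}; they are determined by the next two axioms. *)
  carnot_X : 'I_(ns (first_layer hr)) -> layers_rV R ns -> layers_rV R ns;
  carnot_X_left_invariant : forall k a x,
    carnot_X k (carnot_op a x) = 'D_(carnot_X k x) (carnot_op a) x;
  carnot_X0 : forall k, carnot_X k 0 = delta_mx 0 (tagnat.Rank (first_layer hr) k);
  carnot_hormander : forall x, exists Y : 'I_(\sum_j ns j) -> layers_rV R ns -> layers_rV R ns,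
    (forall i, Lie carnot_X (Y i)) /\
    \rank (\matrix_i Y i x) = (\sum_j ns j)%N
}.

Section carnot.
Context {R : realType} {r : nat} {hr : (1 < r)%N} {ns : 'I_r -> nat}.
Variable G : carnotGroup R hr ns.
Local Notation n := (\sum_j ns j)%N.
Local Notation RG := 'rV[R]_n.

Definition horizontal (delta : R) (gamma : R -> RG) :=
  absolutely_continuous_on 0 delta gamma /\
  exists a : 'I_(ns (first_layer hr)) -> R -> R,
    {ae lebesgue_measure, forall t : R, 0 <= t <= delta ->
      is_derive t 1 gamma (\sum_i a i t *: carnot_X G i (gamma t)) /\
      \sum_i a i t ^+ 2 <= 1}.

(* Valued in [\bar R], so that the infimum over no curve would be +oo. *)
Definition d_cc (x y : RG) : \bar R :=
  ereal_inf [set delta%:E | delta in [set delta : R | 0 < delta /\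
    exists gamma, [/\ gamma 0 = x, gamma delta = y & horizontal delta gamma]]].

Definition Zn_subgroup : Prop :=
  (forall k l : 'rV[int]_n, exists m : 'rV[int]_n,
     carnot_op G (int_rV k) (int_rV l) = int_rV m) /\
  (forall k : 'rV[int]_n, exists m : 'rV[int]_n, carnot_inv G (int_rV k) = int_rV m).

Definition torus_rel : rel RG :=
  fun x y => `[< exists k : 'rV[int]_n, carnot_op G (int_rV k) x = y >].

Local Open Scope quotient_scope.

Hypothesis hZ : Zn_subgroup.

Lemma torus_rel_refl : reflexive torus_rel.
Proof.
move=> x; apply/asboolP; exists 0; rewrite (_ : int_rV 0 = 0) ?carnot_op0x//.
by apply/rowP => i; rewrite !mxE.
Qed.

Lemma torus_rel_sym : symmetric torus_rel.
Proof.
suff sub x y : torus_rel x y -> torus_rel y x by move=> x y; apply/idP/idP; exact: sub.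
move=> /asboolP[k <-]; apply/asboolP; have [m km] := hZ.2 k.
by exists m; rewrite -km carnot_opA carnot_opVx carnot_op0x.
Qed.

Lemma torus_rel_trans : transitive torus_rel.
Proof.
move=> y x z /asboolP[k <-] /asboolP[l <-]; apply/asboolP.
by have [m lk] := hZ.1 l k; exists m; rewrite -lk carnot_opA.
Qed.

Definition torus_equiv : equiv_rel RG :=
  EquivRel torus_rel torus_rel_refl torus_rel_sym torus_rel_trans.

Definition torus := quotient_topology {eq_quot torus_equiv}.

Definition torus_pi : RG -> torus := \pi_torus.

Definition borel_torus := g_sigma_algebraType (@open torus).

Definition cube : set RG := [set x | forall i, 0 <= x 0 i < 1].

(* The identification of the torus with [0,1)^n; the default value 0 of [xget] is
   never used, since every class meets the cube in exactly one point. *)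
Definition cube_repr (t : borel_torus) : RG :=
  xget 0 [set x | cube x /\ torus_pi x = t].

Lemma measurable_cube : measurable (cube : set (borel_rV R n)).
Proof.
rewrite (_ : cube = \bigcap_(i in [set: 'I_n])
    ((fun x : borel_rV R n => (x : RG) 0 i) @^-1` `[0, 1[)).
  apply: fin_bigcap_measurable => // i _; rewrite -[X in measurable X]setTI.
  exact: measurable_coord.
apply/seteqP; split => [x cx i _|x cx i]; first by rewrite /= in_itv /=; exact: cx.
by have := cx i I; rewrite /= in_itv.
Qed.

Lemma measurable_torus_pi :
  measurable_fun [set: borel_rV R n] (torus_pi : borel_rV R n -> borel_torus).
Proof.
apply: (measurability _ (erefl : @measurable _ borel_torus = <<s @open torus >>)).
by move=> _ [U oU <-]; rewrite setTI; exact: measurable_open_rV.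
Qed.

Definition lebesgue_torus : set borel_torus -> \bar R :=
  pushforward (mrestr (lebesgue_rV R n) measurable_cube)
    (torus_pi : borel_rV R n -> borel_torus).

Let lebesgue_torus0 : lebesgue_torus set0 = 0%E.
Proof. by rewrite /lebesgue_torus /pushforward preimage_set0 measure0. Qed.

Let lebesgue_torus_ge0 A : (0 <= lebesgue_torus A)%E.
Proof. exact: (measure_ge0 (mrestr (lebesgue_rV R n) measurable_cube)). Qed.

Let lebesgue_torus_sigma_additive : semi_sigma_additive lebesgue_torus.
Proof.
have mpi := measurable_torus_pi.
exact: (@measure_semi_sigma_additive _ _ _ (pushforward
  (mrestr (lebesgue_rV R n) measurable_cube)
  (torus_pi : borel_rV R n -> borel_torus))).
Qed.

HB.instance Definition _ := isMeasure.Build _ _ _ lebesgue_torus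
  lebesgue_torus0 lebesgue_torus_ge0 lebesgue_torus_sigma_additive.

Definition d_cc_torus (s t : torus) : \bar R :=
  ereal_inf [set d_cc xy.1 xy.2 | xy in
    [set xy : RG * RG | torus_pi xy.1 = s /\ torus_pi xy.2 = t]].

Definition lipschitz1 (phi : borel_torus -> R) :=
  forall s t, (`|phi s - phi t|%:E <= d_cc_torus s t)%E.

Definition KR_dist (m m' : probability borel_torus R) : \bar R :=
  ereal_sup [set (\int[m]_t (phi t)%:E - \int[m']_t (phi t)%:E)%E |
    phi in lipschitz1].

(* The sum over k does not depend on the representative of x, but it does depend
   on that of y, which has to be the one in [0,1)^n. *)
Definition mollified_density (C eps : R) (mu : probability borel_torus R)
    (x : borel_torus) : \bar R :=
  (\int[mu]_y \esum_(k in [set: 'rV[int]_n])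
     (mollifier C eps (carnot_op G (carnot_op G (int_rV k) (cube_repr x))
                     (carnot_inv G (cube_repr y))))%:E)%E.

End carnot.

Arguments lebesgue_torus {R r hr ns G} hZ A.

(* Main.v *)
From HB Require Import structures.
Require Import Defs.
From mathcomp Require Import all_boot all_order all_algebra.
From mathcomp Require Import all_classical all_reals all_analysis.
From mathcomp Require Import measurable_realfun ring lra.

Set Implicit Arguments.
Unset Strict Implicit.
Unset Printing Implicit Defensive.

Import Order.TTheory GRing.Theory Num.Theory numFieldNormedType.Exports.

Local Open Scope classical_set_scope.
Local Open Scope ring_scope.

(** Why the mollified measures converge.

    Let [y] be a random point of the unit cube whose class has law [mu] and let [w]
    be an independent random point of the group with density [psi_eps].  Then [mu_eps]
    is the law of the class of [w o y] ([smoothing_density]): right translations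
    preserve Lebesgue measure, so [w o y] has density [psi_eps (x o y^-1)], and
    passing to classes sums this density over the lattice.  Hence the classes of
    [w o y] and of [y] form a coupling of [mu_eps] and [mu], and
    [KR_dist mu_eps mu] is at most the supremum of [d_cc (w o y) y] over [y] in
    the cube and [w] in the support of [psi_eps] ([KR_dist_coupling]).

    This support shrinks to the origin.  As [w o y] is [y] translated on the right
    by [(w o y)^-1 o y], which tends to 0 with [w], uniformly over the relatively
    compact cube, it remains to see that [d_cc x (x o u)] tends to 0 with [u],
    uniformly in [x] ([d_cc_small]).  This is Chow's theorem.  It also makes
    functions that are Lipschitz for [d_cc] continuous, hence measurable, and
    bounded on the torus, so that the integrals compared by [KR_dist] are finite.

    In a homogeneous group Chow's theorem has an elementary proof, which needs
    neither the existence theorem for differential equations nor the inverse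
    function theorem.

    - Homogeneity under the dilations makes the group law triangular: the [i]-th
      coordinate of [x o y] is [x_i + y_i] plus a function of the coordinates of
      smaller weight ([op_lower]).  Its leading correction is bilinear
      ([op_bilinear]), and the antisymmetrisation of this bilinear form computes
      the brackets of left-invariant fields ([lie_bracket_left_field]).
      The triangular form also gives the invariance of Lebesgue measure
      ([lebesgue_rV_shear]) and the fundamental domain of the lattice
      ([cube_translate_ex], [cube_translate_uniq]).

    - The integral curve of [X_k] through the origin is [t |-> dilation t c],
      where [c] solves a triangular system of equations ([flow_path]).  A word is a
      product of points on these curves and of their inverses; right multiplication
      by a word follows a horizontal path whose duration does not depend on
      the starting point.

    - Consider the coordinates of smallest weight of a word.  Products of words
      add them, dilations scale them, and commutators realise the bracket
      ([leads_bracket]).  By the Hormander condition every vector then occurs as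
      the leading part of a word ([leads_all]).

    - A small point is written as a short word by cancelling its coordinates one
      after the other with dilated words ([small_words]). *)

(** * Differential calculus *)

Lemma cvg_sumr {R : realType} {W : normedModType R} {I T : Type} (F : set_system T)
    (r : seq I) (P : pred I) (g : I -> T -> W) (a : I -> W) : Filter F ->
  (forall i, P i -> g i x @[x --> F] --> a i) ->
  \sum_(i <- r | P i) g i x @[x --> F] --> \sum_(i <- r | P i) a i.
Proof. by move=> FF gP; apply: cvg_big => //; exact: add_continuous. Qed.

Section line_derivative.
Context {R : realType} {V W : normedModType R}.
Implicit Types (f : V -> W) (x v : V) (s : R).

Lemma is_derive_line f x v s : derivable f (x + s *: v) v ->
  is_derive s 1 (fun t => f (x + t *: v)) ('D_v f (x + s *: v)).
Proof.
have E : (fun h : R => h^-1 *: (((fun t => f (x + t *: v)) \o shift s) (h *: 1) - f (x + s *: v)))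
       = (fun h : R => h^-1 *: ((f \o shift (x + s *: v)) (h *: v) - f (x + s *: v))).
  apply/funext => h /=; congr (_ *: (f _ - _)).
  by rewrite [h *: 1]mulr1 scalerDl addrCA.
by move=> df; apply: DeriveDef; rewrite /derivable /derive E.
Qed.

End line_derivative.

Section mean_value.
Context {R : realType} {V : normedModType R}.
Implicit Types (f : V -> R) (x v : V).

Lemma mean_value (g dg : R -> R) (a : R) :
  (forall s : R, is_derive s 1 g (dg s)) ->
  exists2 s, `|s| <= `|a| & g a - g 0 = a * dg s.
Proof.
move=> dgP.
have cg : continuous g.
  move=> s; apply: differentiable_continuous; apply/derivable1_diffP.
  by have := dgP s; case.
case: (leP 0 a) => a0.
  have [s] := MVT_segment a0 (fun s _ => dgP s) (continuous_subspaceT cg).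
  rewrite in_itv /= subr0 => /andP[s0 sa] ->; exists s; last by rewrite mulrC.
  by rewrite !ger0_norm.
have [s] := MVT_segment (ltW a0) (fun s _ => dgP s) (continuous_subspaceT cg).
rewrite in_itv /= => /andP[sa s0] E; exists s.
  by rewrite !ler0_norm // ?lerN2// ltW.
by rewrite -opprB E sub0r mulrN opprK mulrC.
Qed.

Lemma mean_value_line f x v (a : R) : (forall y, derivable f y v) ->
  exists2 s, `|s| <= `|a| &
    f (x + a *: v) - f x = a * 'D_v f (x + s *: v).
Proof.
move=> df; have [s sa E] := @mean_value (fun t => f (x + t *: v))
  (fun t => 'D_v f (x + t *: v)) a (fun s => is_derive_line (df _)).
by exists s => //; rewrite -E scale0r addr0.
Qed.

End mean_value.

(** [e] and [c] are a finite frame of a normed space together with its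
    coordinates; both ['rV_n] and ['rV_n * 'rV_n] have one. *)
Definition framed {R : realType} {V : normedModType R} {I : finType}
    (e : I -> V) (c : I -> V -> R) :=
  [/\ forall i, linear_for *%R (c i), forall i, continuous (c i) &
      forall v, v = \sum_i c i v *: e i].

Section C1_differentiable.
Context {R : realType} {V : normedModType R} {I : finType}.
Variables (e : I -> V) (c : I -> V -> R).
Hypothesis ec : framed e c.
Implicit Types (f : V -> R) (x v : V).

Let c_linear i : linear_for *%R (c i). Proof. by case: ec. Qed.

Let c0 i : c i 0 = 0.
Proof. by have := @c_linear i (-1) 0 0; rewrite scaler0 addr0 mulN1r addNr. Qed.

Let cZ i (a : R) v : c i (a *: v) = a * c i v.
Proof. by have := @c_linear i a v 0; rewrite addr0 c0 addr0. Qed.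

Let c_bounded i : exists2 K : R, 0 < K & forall v, `|c i v| <= K * `|v|.
Proof.
have cc : continuous (c i) by case: ec.
have /cvgrPdist_lt/(_ 1 ltr01)/nbhs_ballP[d /= d0 dP] := cc 0.
exists (2 / d); first by rewrite divr_gt0.
move=> v; have [->|v0] := eqVneq v 0; first by rewrite c0 !normr0 mulr0.
have nv : 0 < `|v| by rewrite normr_gt0.
set a := d / 2 / `|v|.
have a0 : 0 < a by rewrite divr_gt0// divr_gt0.
have /dP : ball 0 d (a *: v).
  rewrite -ball_normE /= sub0r normrN normrZ gtr0_norm// divfK ?gt_eqF//.
  by rewrite ltr_pdivrMr// ltr_pMr// ltr1n.
rewrite c0 sub0r normrN cZ normrM gtr0_norm// => /ltW.
rewrite mulrC -ler_pdivlMr// div1r => /le_trans; apply.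
by rewrite /a invfM invrK mulrC invf_div mulrC.
Qed.

(** The coordinates are moved one at a time, the mean value theorem being applied
    to each move; the sequence [s] lists those already moved. *)
Let partial_sum f x (s : seq I) : (forall i y, derivable f y (e i)) ->
  (forall i, {for x, continuous ('D_(e i) f)}) ->
  forall eps, 0 < eps -> \forall h \near (0 : V),
    `|f (x + \sum_(i <- s) c i h *: e i) - f x
      - \sum_(i <- s) c i h * 'D_(e i) f x| <= eps * `|h|.
Proof.
move=> df cf; elim: s => [|i s IH] eps eps0.
  by near=> h; rewrite !big_nil addr0 !subrr normr0 mulr_ge0// ltW.
have [K K0 cK] := c_bounded i.
have eps2 : 0 < eps / 2 by rewrite divr_gt0.
have epsK : 0 < eps / 2 / K by rewrite !divr_gt0.
have /cvgrPdist_le/(_ _ epsK)/nbhs_ballP[d /= d0 dP] := cf i.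
have csum : (fun h : V => `|\sum_(i <- s) c i h *: e i| + K * `|h| * `|e i|) @ (0 : V) --> (0 : R).
  rewrite -[X in _ --> X](_ : `|\sum_(i <- s) c i 0 *: e i| + K * `|0 : V| * `|e i| = 0); last first.
    by rewrite normr0 mulr0 mul0r addr0 big1 ?normr0// => j _; rewrite c0 scale0r.
  apply: cvgD.
    apply: cvg_norm; apply: cvg_sumr => j _.
    by apply: cvgZr_tmp; case: ec => _ + _; apply.
  by apply: cvgMr_tmp; apply: cvgMl_tmp; apply: cvg_norm; exact: cvg_id.
near=> h.
rewrite !big_cons; set p := \sum_(j <- s) _ *: _; set q := \sum_(j <- s) _ * _.
have [t tc E] := @mean_value_line R V f (x + p) (e i) (c i h) (df i).
have -> : f (x + (c i h *: e i + p)) - f x - (c i h * 'D_(e i) f x + q)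
    = (f (x + p) - f x - q) + c i h * ('D_(e i) f (x + p + t *: e i) - 'D_(e i) f x).
  rewrite mulrBr -E -[x + p + _]addrA [p + c i h *: _]addrC; ring.
rewrite (le_trans (ler_normD _ _))// (splitr eps) mulrDl lerD//.
  by rewrite /p /q; near: h; exact: IH.
rewrite normrM.
have : `|'D_(e i) f (x + p + t *: e i) - 'D_(e i) f x| <= eps / 2 / K.
  rewrite distrC; apply: dP; rewrite -ball_normE /= -addrA opprD addNKr normrN.
  apply: le_lt_trans (ler_normD _ _) _; rewrite normrZ.
  apply: (@le_lt_trans _ _ (`|p| + K * `|h| * `|e i|)).
    by rewrite lerD2l ler_wpM2r// (le_trans tc).
  rewrite /p; near: h.
  have /cvgrPdist_lt/(_ _ d0) := csum.
  apply: filterS => h; rewrite sub0r normrN => /(le_lt_trans _); apply.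
  exact: ler_norm.
move=> /(ler_pM (normr_ge0 _) (normr_ge0 _) (cK h)) /le_trans; apply.
by rewrite mulrAC mulrCA divff ?gt_eqF// mulr1.
Unshelve. all: by end_near. Qed.

(** Smoothness is phrased with directional derivatives, whereas the chain rule
    needs differentiability; this bridges the two in finite dimension. *)
Lemma continuous_partials_differentiable f x : (forall i y, derivable f y (e i)) ->
  (forall i, {for x, continuous ('D_(e i) f)}) -> differentiable f x.
Proof.
move=> df cf.
pose d v := \sum_i c i v * 'D_(e i) f x.
have d_lin : linear_for *%R d.
  move=> a u v; rewrite /d mulr_sumr -big_split /=; apply: eq_bigr => i _.
  by rewrite c_linear mulrDl mulrA.
pose dM := GRing.isLinear.Build _ _ _ _ _ (d_lin : linear (d : V -> R^o)).
pose dL : {linear V -> R^o} := HB.pack d dM.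
have cd : continuous (dL : V -> R).
  move=> v; apply: cvg_sumr => i _; apply: cvgMr_tmp; by case: ec => _ + _; apply.
suff Ef : f \o shift x = cst (f x) + dL +o_ 0 id.
  by have dE := diff_unique cd Ef; apply/diff_locallyP; rewrite dE.
apply/eqaddoP => eps eps0; near=> h.
have -> : (f \o shift x - (cst (f x) + (dL : V -> R))) h = f (x + \sum_i c i h *: e i) - f x
      - \sum_i c i h * 'D_(e i) f x.
  rewrite !fctE /=; case: ec => _ _ <-; rewrite opprD addrA [h + x]addrC; done.
near: h; exact: partial_sum.
Unshelve. all: by end_near. Qed.

End C1_differentiable.

Section frames.
Context {R : realType}.

Lemma framed_rV n :
  framed (fun i : 'I_n => delta_mx 0 i : 'rV[R]_n) (fun i v => v 0 i).
Proof.
split=> [i a u v|i|v]; first by rewrite !mxE.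
  exact: coord_continuous.
exact: row_sum_delta.
Qed.

Lemma framed_prod (V W : normedModType R) (I J : finType)
    (e : I -> V) (c : I -> V -> R) (e' : J -> W) (c' : J -> W -> R) :
  framed e c -> framed e' c' ->
  framed (fun k : I + J => match k with inl i => (e i, 0) | inr j => (0, e' j) end : V * W)
    (fun k p => match k with inl i => c i p.1 | inr j => c' j p.2 end).
Proof.
move=> [cl cc ce] [cl' cc' ce']; split=> [[i|j] a u v|[i|j]|[v w]] /=.
- exact: cl.
- exact: cl'.
- by move=> p; apply: continuous_comp; [exact: cvg_fst|exact: cc].
- by move=> p; apply: continuous_comp; [exact: cvg_snd|exact: cc'].
rewrite big_sumType /=.
have -> : \sum_i c i v *: (e i, 0 : W) = (v, 0).
  rewrite [in RHS](ce v); elim/big_rec2: _ => // i x y _ ->.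
  by congr pair; rewrite /= scaler0 add0r.
have -> : \sum_i c' i w *: (0 : V, e' i) = (0, w).
  rewrite [in RHS](ce' w); elim/big_rec2: _ => // i x y _ ->.
  by congr pair; rewrite /= scaler0 add0r.
by congr pair; rewrite /= ?addr0 ?add0r.
Qed.

End frames.

Section smooth_functions.
Context {R : realType} {V W : normedModType R}.
Implicit Types (f : V -> W).

Lemma smooth_continuous f : smooth f -> continuous f.
Proof. by move=> /(_ 0%N)[]. Qed.

Lemma smooth_derivable f x v : smooth f -> derivable f x v.
Proof. by move=> /(_ 1%N)[_ /(_ v)[+ _]]; apply. Qed.

Lemma smooth_derive f v : smooth f -> smooth ('D_v f).
Proof. by move=> sf k; have [_ /(_ v)[_]] := sf k.+1. Qed.

End smooth_functions.

Section smooth_scalar_functions.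
Context {R : realType} {V : normedModType R}.

Lemma smooth_differentiable (g : V -> R) (I : finType) (e : I -> V) c x :
  framed e c -> smooth g -> differentiable g x.
Proof.
move=> ec sg; apply: (continuous_partials_differentiable ec) => [i y|i].
  exact: smooth_derivable.
exact/smooth_continuous/smooth_derive.
Qed.

Lemma smooth_coord n (f : V -> 'rV[R]_n) (i : 'I_n) :
  smooth f -> smooth (fun x => f x 0 i).
Proof.
move=> + k; elim: k f => [|k IH] f sf.
  split=> // x; apply: (@continuous_comp _ _ _ f (fun M : 'rV[R]_n => M 0 i)).
    exact: smooth_continuous.
  exact: coord_continuous.
split.
  move=> x; apply: (@continuous_comp _ _ _ f (fun M : 'rV[R]_n => M 0 i)).
    exact: smooth_continuous.
  exact: coord_continuous.
move=> v; have dfi x : derivable (fun x => f x 0 i) x v.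
  by have /derivable_mxP := smooth_derivable (x := x) (v := v) sf; apply.
split=> //; have -> : 'D_v (fun x => f x 0 i) = fun x => ('D_v f) x 0 i.
  by apply/funext => x; rewrite derive_mx ?mxE//; exact: smooth_derivable.
exact/IH/smooth_derive.
Qed.

End smooth_scalar_functions.

Section directional_derivatives.
Context {R : realType} {V W : normedModType R}.

Lemma derive_lincomb (I : finType) (a : I -> R) (v : I -> V) (f : V -> W) x :
  differentiable f x ->
  'D_(\sum_i a i *: v i) f x = \sum_i a i *: 'D_(v i) f x.
Proof.
move=> df; rewrite deriveE// linear_sum; apply: eq_bigr => i _.
by rewrite linearZ deriveE.
Qed.

Lemma deriveZv (a : R) v (f : V -> W) x :
  differentiable f x -> 'D_(a *: v) f x = a *: 'D_v f x.
Proof. by move=> df; rewrite !deriveE// linearZ. Qed.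

Lemma is_derive_comp (f : V -> W) (c : R -> V) (s : R) v :
  differentiable f (c s) -> is_derive s 1 c v ->
  is_derive s 1 (f \o c) ('D_v f (c s)).
Proof.
move=> df [dc <-]; have dcs : differentiable c s by apply/derivable1_diffP.
have dfc : differentiable (f \o c) s by exact: differentiable_comp.
apply: DeriveDef; first exact/derivable1_diffP.
rewrite deriveE// diff_comp// [in RHS]deriveE// [in RHS]deriveE//.
Qed.

End directional_derivatives.

Section schwarz.
Context {R : realType} {V : normedModType R}.
Implicit Types (f : V -> R) (x u v : V).

Let ler_distD_half (a b c eps : R) :
  `|a - c| <= eps / 2 -> `|b - c| <= eps / 2 -> `|a - b| <= eps.
Proof.
move=> ac bc; rewrite (le_trans (ler_distD c _ _))// (splitr eps) lerD//.
by rewrite distrC.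
Qed.

(** The second difference is symmetric in [u] and [v], whereas its expression by
    the mean value theorem is not: comparing the two expressions gives the symmetry
    of second derivatives. *)
Lemma second_difference f x u v (h : R) : smooth f ->
  exists2 s, `|s| <= `|h| & exists2 t, `|t| <= `|h| &
  f (x + h *: u + h *: v) - f (x + h *: u) - f (x + h *: v) + f x =
    h * (h * 'D_v ('D_u f) (x + s *: u + t *: v)).
Proof.
move=> sf.
pose g s := f (x + h *: v + s *: u) - f (x + s *: u).
have dg (s : R) : is_derive s 1 g ('D_u f (x + h *: v + s *: u) - 'D_u f (x + s *: u)).
  by apply: is_deriveB; apply: is_derive_line; exact: smooth_derivable.
have [s sh E] := mean_value h dg; exists s => //.
have [t th E'] := @mean_value_line R V ('D_u f) (x + s *: u) v h
  (fun y => smooth_derivable (smooth_derive u sf)).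
exists t => //; rewrite -E' [x + s *: u + _]addrAC -E /g !scale0r !addr0.
by rewrite [x + h *: u + _]addrAC; ring.
Qed.

Lemma schwarz f x u v : smooth f -> 'D_u ('D_v f) x = 'D_v ('D_u f) x.
Proof.
move=> sf; apply/eqP; rewrite -subr_eq0 -normr_le0; apply/ler_addgt0Pr => eps eps0.
rewrite add0r.
have eps2 : 0 < eps / 2 by rewrite divr_gt0.
have near_x (g : V -> R) (a b : V) : continuous g -> exists2 d : R, 0 < d &
    forall s t : R, `|s| <= d -> `|t| <= d -> `|g x - g (x + s *: a + t *: b)| <= eps / 2.
  move=> cg; have /cvgrPdist_le/(_ _ eps2)/nbhs_ballP[d /= d0 dP] := cg x.
  exists (d / 2 / (`|a| + `|b| + 1)) => [|s t sd td].
    by rewrite !divr_gt0// ltr_wpDl// addr_ge0.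
  apply: dP; rewrite -ball_normE /= -addrA opprD addNKr normrN.
  apply: le_lt_trans (ler_normD _ _) _; rewrite !normrZ.
  set k := `|a| + _ + _ in sd td; have k0 : 0 < k by rewrite ltr_wpDl// addr_ge0.
  apply: (@le_lt_trans _ _ (d / 2 / k * `|a| + d / 2 / k * `|b|)).
    by rewrite lerD// ler_wpM2r.
  rewrite -mulrDr mulrAC ltr_pdivrMr//.
  apply: (@le_lt_trans _ _ (d / 2 * k)); last by rewrite ltr_pM2r// ltr_pdivrMr// ltr_pMr// ltr1n.
  by rewrite ler_pM2l ?divr_gt0// /k lerDl.
have [d1 d10 P1] := near_x ('D_u ('D_v f)) v u (smooth_continuous (smooth_derive _ (smooth_derive _ sf))).
have [d2 d20 P2] := near_x ('D_v ('D_u f)) u v (smooth_continuous (smooth_derive _ (smooth_derive _ sf))).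
pose h := Num.min d1 d2; have h0 : 0 < h by rewrite lt_min d10.
have hd1 : `|h| <= d1 by rewrite gtr0_norm// ge_min lexx.
have hd2 : `|h| <= d2 by rewrite gtr0_norm// ge_min lexx orbT.
have [s sh [t th E]] := second_difference x v u h sf.
have [s' sh' [t' th' E']] := second_difference x u v h sf.
have EE : 'D_u ('D_v f) (x + s *: v + t *: u) = 'D_v ('D_u f) (x + s' *: u + t' *: v).
  have hh : h != 0 by rewrite gt_eqF.
  apply: (mulfI hh); apply: (mulfI hh); apply: etrans E' => //.
  by apply: etrans (esym E) _; rewrite [x + _ + _]addrAC; ring.
have := P2 _ _ (le_trans sh' hd2) (le_trans th' hd2); rewrite -EE.
have := P1 _ _ (le_trans sh hd1) (le_trans th hd1).
exact: ler_distD_half.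
Qed.

End schwarz.

(** * Dilations and homogeneous functions *)

Section dilations.
Context {R : realType} {r : nat} {ns : 'I_r -> nat}.
Local Notation n := (\sum_j ns j)%N.
Local Notation RG := 'rV[R]_n.
Implicit Types (x y : RG) (i : 'I_n) (l : R).

Definition weight i : nat := (tagnat.sig1 i).+1.

Lemma weight_gt0 i : (0 < weight i)%N. Proof. by []. Qed.

Lemma weight_le (i j : 'I_n) : (i <= j)%N -> (weight i <= weight j)%N.
Proof. by move=> ij; rewrite ltnS; exact: (@tagnat.le_sig1 _ ns i j). Qed.

Lemma weight_ltW (i j : 'I_n) : (weight i < weight j)%N -> (i < j)%N.
Proof. by apply: contraTT; rewrite -!leqNgt; exact: weight_le. Qed.

Lemma dilationE l x i : dilation l x 0 i = l ^+ weight i * x 0 i.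
Proof. rewrite /dilation !mxE. by congr (_ * x _ _); exact: tagnat.sig2K. Qed.

Lemma dilationD l x y : dilation l (x + y) = dilation l x + dilation l y.
Proof. by apply/rowP => i; rewrite !(dilationE, mxE) mulrDr. Qed.

Lemma dilationZ l (a : R) x : dilation l (a *: x) = a *: dilation l x.
Proof. by apply/rowP => i; rewrite !(dilationE, mxE) mulrCA. Qed.

Lemma dilation0 l : dilation l (0 : RG) = 0.
Proof. by apply/rowP => i; rewrite !(dilationE, mxE) mulr0. Qed.

Lemma dilation1 x : dilation 1 x = x.
Proof. by apply/rowP => i; rewrite dilationE expr1n mul1r. Qed.

Lemma dilationM (l l' : R) x : dilation l (dilation l' x) = dilation (l * l') x.
Proof. by apply/rowP => i; rewrite !dilationE exprMn mulrA. Qed.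

Lemma dilation_delta l i : dilation l (delta_mx 0 i : RG) = l ^+ weight i *: delta_mx 0 i.
Proof.
apply/rowP => j; rewrite !(dilationE, mxE) eqxx /=.
by case: (eqVneq j i) => [->|]; rewrite ?mulr1 ?mulr0.
Qed.

Lemma dilation_cvg0 x : dilation l x @[l --> 0] --> (0 : RG).
Proof.
have : (fun l => dilation l x) = (fun l => \sum_i (l ^+ weight i * x 0 i) *: (delta_mx 0 i : RG)).
  apply/funext => l; rewrite [LHS]row_sum_delta; apply: eq_bigr => i _.
  by rewrite dilationE.
move=> ->; rewrite (_ : nbhs (0 : RG) = nbhs (\sum_i (0 ^+ weight i * x 0 i) *: (delta_mx 0 i : RG))); last first.
  by congr nbhs; apply/esym; apply: big1 => i _; rewrite expr0n mul0r scale0r.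
apply: cvg_sumr => i _; apply: cvgZr_tmp; apply: cvgMr_tmp.
exact: exprn_continuous.
Qed.

Definition dilation2 l (p : RG * RG) := (dilation l p.1, dilation l p.2).

Lemma dilation2_inl l i : dilation2 l (delta_mx 0 i, 0) = l ^+ weight i *: (delta_mx 0 i, 0).
Proof. by rewrite /dilation2 /= dilation_delta dilation0; congr pair; rewrite scaler0. Qed.

Lemma dilation2_inr l i : dilation2 l (0, delta_mx 0 i) = l ^+ weight i *: (0, delta_mx 0 i).
Proof. by rewrite /dilation2 /= dilation_delta dilation0; congr pair; rewrite scaler0. Qed.

Lemma dilation2_cvg0 p : dilation2 l p @[l --> 0^'+] --> (0 : RG * RG).
Proof.
apply: cvg_at_right_filter.
exact: (cvg_pair (dilation_cvg0 p.1) (dilation_cvg0 p.2)).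
Qed.

Lemma framed_pair : framed
    (fun k : 'I_n + 'I_n => match k with
      | inl i => (delta_mx 0 i, 0) | inr j => (0, delta_mx 0 j) end : RG * RG)
    (fun k p => match k with inl i => p.1 0 i | inr j => p.2 0 j end).
Proof. exact: (framed_prod (framed_rV n) (framed_rV n)). Qed.

End dilations.

Section homogeneous_functions.
Context {R : realType} {r : nat} {ns : 'I_r -> nat}.
Local Notation n := (\sum_j ns j)%N.
Local Notation P := ('rV[R]_n * 'rV[R]_n)%type.
Implicit Types (f : P -> R) (p v : P).

(** Homogeneity of degree [m - a]; this degree becomes negative when one
    differentiates, whence the two exponents. *)
Definition homogeneous a m f :=
  forall l : R, 0 < l -> forall p, l ^+ a * f (dilation2 l p) = l ^+ m * f p.

(** Differentiating in a direction which the dilations scale by [l ^ b] lowers the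
    degree by [b]. *)
Lemma homogeneous_derive a m b f v : smooth f ->
  (forall l, dilation2 l v = l ^+ b *: v) ->
  homogeneous a m f -> homogeneous (a + b) m ('D_v f).
Proof.
move=> sf vb hf l l0 p.
have df q : differentiable f q by exact: smooth_differentiable framed_pair sf.
have d1 : is_derive (0 : R) 1 (fun s => l ^+ m * f (p + s *: v)) (l ^+ m * 'D_v f p).
  rewrite -{2}[p]addr0 -[X in p + X](scale0r v).
  by apply: is_deriveZ; apply: is_derive_line; exact: smooth_derivable.
have d2 : is_derive (0 : R) 1 (fun s => l ^+ a * f (dilation2 l p + s *: (l ^+ b *: v)))
    (l ^+ a * 'D_(l ^+ b *: v) f (dilation2 l p)).
  rewrite -{2}[dilation2 l p]addr0 -[X in dilation2 l p + X](scale0r (l ^+ b *: v)).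
  by apply: is_deriveZ; apply: is_derive_line; exact: smooth_derivable.
have E : (fun s : R => l ^+ m * f (p + s *: v)) =
         (fun s => l ^+ a * f (dilation2 l p + s *: (l ^+ b *: v))).
  apply/funext => s; rewrite -hf//; congr (_ * f _).
  by rewrite -vb; congr pair; rewrite /= dilationD dilationZ.
have /@derive_val D2 := d2; have /@derive_val := d1; rewrite E D2 => <-.
rewrite deriveZv; last exact: df.
by move: ('D_v f _) => c; rewrite exprD -mulrA.
Qed.

(** A continuous function of degree at most 0 is governed by its value at the
    origin, to which the dilations contract every point. *)
Lemma homogeneous_const a m f p : continuous f -> homogeneous a m f -> (m <= a)%N ->
  f p = 0 ^+ (a - m) * f 0.
Proof.
move=> cf hf ma.
have E : {near 0^'+, (fun l : R => l ^+ (a - m) * f (dilation2 l p)) =1 (fun=> f p)}.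
  near=> l; have l0 : 0 < l by [].
  have lm : l ^+ m != 0 by rewrite expf_neq0 ?gt_eqF.
  by apply: (mulfI lm); rewrite -[RHS]hf// mulrA -exprD subnKC.
have L : f p @[l --> (0 : R)^'+] --> 0 ^+ (a - m) * f 0.
  refine (cvg_trans (near_eq_cvg E) _); apply: cvgM.
    by apply: cvg_at_right_filter; exact: exprn_continuous.
  apply: (@cvg_comp _ _ _ (fun l : R => dilation2 l p) f _ (nbhs (0 : P))).
    exact: dilation2_cvg0.
  exact: (cf 0).
exact: (cvg_unique (@norm_hausdorff R R^o) (cvg_cst (f p)) L).
Unshelve. all: by end_near. Qed.

(** The origin is fixed by the dilations, so that only functions of degree 0 can be
    nonzero there. *)
Lemma homogeneous_at0 a m f : homogeneous a m f -> a != m -> f 0 = 0.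
Proof.
move=> hf; have := hf 2 (ltr0Sn _ 1) 0.
rewrite (_ : dilation2 _ 0 = 0); last by congr pair; exact: dilation0.
move=> /eqP; rewrite -subr_eq0 -mulrBl mulf_eq0 => /orP[|/eqP//].
by rewrite subr_eq0 => /eqP/ieexprIn ->; rewrite ?eqxx ?ltr0n// pnatr_eq1.
Qed.

End homogeneous_functions.

(** * Triangular form of the group law *)

Section group_law.
Context {R : realType} {r : nat} {hr : (1 < r)%N} {ns : 'I_r -> nat}.
Variable G : carnotGroup R hr ns.
Local Notation n := (\sum_j ns j)%N.
Local Notation RG := 'rV[R]_n.
Local Notation P := (RG * RG)%type.
Local Notation op := (carnot_op G).
Local Notation inv := (carnot_inv G).
Implicit Types (x y u v : RG) (p : P) (i j a b : 'I_n).

(** Coordinates of the group law, as functions of a pair, so that partial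
    derivatives in either factor are directional derivatives. *)
Definition op_coord i (p : P) : R := op p.1 p.2 0 i.

Definition left_unit i : P := (delta_mx 0 i, 0).
Definition right_unit i : P := (0, delta_mx 0 i).

Lemma left_unitE x : (x, 0) = \sum_i x 0 i *: left_unit i.
Proof.
have [_ _ /(_ (x, 0))E] := @framed_pair R r ns; rewrite [LHS]E big_sumType /=.
by rewrite [X in _ + X]big1 ?addr0// => j _; rewrite mxE scale0r.
Qed.

Lemma right_unitE x : (0, x) = \sum_i x 0 i *: right_unit i.
Proof.
have [_ _ /(_ (0, x))E] := @framed_pair R r ns; rewrite [LHS]E big_sumType /=.
by rewrite [X in X + _]big1 ?add0r// => j _; rewrite mxE scale0r.
Qed.

Lemma op_coord_smooth i : smooth (op_coord i).
Proof. exact: smooth_coord (carnot_op_smooth G). Qed.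

Lemma smooth_diff (f : P -> R) p : smooth f -> differentiable f p.
Proof. exact: smooth_differentiable framed_pair. Qed.

Lemma derive_left (f : P -> R) x p : smooth f ->
  'D_(x, 0) f p = \sum_i x 0 i * 'D_(left_unit i) f p.
Proof. by move=> sf; rewrite left_unitE derive_lincomb//; exact: smooth_diff. Qed.

Lemma derive_right (f : P -> R) x p : smooth f ->
  'D_(0, x) f p = \sum_i x 0 i * 'D_(right_unit i) f p.
Proof. by move=> sf; rewrite right_unitE derive_lincomb//; exact: smooth_diff. Qed.

Lemma derive_leftright (f : P -> R) x y p : smooth f -> 'D_(x, y) f p =
  \sum_i x 0 i * 'D_(left_unit i) f p + \sum_i y 0 i * 'D_(right_unit i) f p.
Proof.
move=> sf; have df := smooth_diff p sf.
have E : (x, y) = (x, 0) + (0, y) by congr pair; rewrite /= ?addr0 ?add0r.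
rewrite [LHS](deriveE (x, y) df) E; apply: etrans (linearD _ _ _) _.
congr (_ + _).
  exact: etrans (esym (deriveE (x, 0) df)) (derive_left x p sf).
exact: etrans (esym (deriveE (0, y) df)) (derive_right y p sf).
Qed.

Lemma op_coord_homogeneous i : homogeneous 0 (weight i) (op_coord i).
Proof.
move=> l l0 p; rewrite expr0 mul1r /op_coord /dilation2 /= -carnot_dilationM//.
exact: dilationE.
Qed.

Lemma derive_left_homogeneous (f : P -> R) (c m : nat) a : smooth f ->
  homogeneous c m f -> homogeneous (c + weight a) m ('D_(left_unit a) f).
Proof. by move=> sf; apply: homogeneous_derive => // l; exact: dilation2_inl. Qed.

Lemma derive_right_homogeneous (f : P -> R) (c m : nat) a : smooth f ->
  homogeneous c m f -> homogeneous (c + weight a) m ('D_(right_unit a) f).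
Proof. by move=> sf; apply: homogeneous_derive => // l; exact: dilation2_inr. Qed.

Let derive_along (f : P -> R) (v : P) (g : R -> R) (d : R) : smooth f ->
  (forall s : R, f (s *: v) = g s) -> is_derive (0 : R) 1 g d -> 'D_v f 0 = d.
Proof.
move=> sf fg dg; have := @is_derive_line R _ _ f 0 v 0.
rewrite scale0r addr0 => /(_ (smooth_derivable sf)).
rewrite (_ : (fun t : R => f _) = g); last by apply/funext => s; rewrite add0r.
by move=> /@derive_val <-; exact: derive_val.
Qed.

Lemma derive_left_op_coord0 i a : 'D_(left_unit a) (op_coord i) 0 = (a == i)%:R.
Proof.
apply: (@derive_along _ _ (fun s => s * (a == i)%:R)); first exact: op_coord_smooth.
  move=> s; rewrite /op_coord /= scaler0 carnot_opx0 !mxE eqxx /=.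
  by rewrite eq_sym.
have -> : (fun s : R => s * (a == i)%:R) = (fun s => (a == i)%:R *: s).
  by apply/funext => s; rewrite mulrC.
by apply: is_derive_eq; rewrite [LHS]mulr1.
Qed.

Lemma derive_right_op_coord0 i a : 'D_(right_unit a) (op_coord i) 0 = (a == i)%:R.
Proof.
apply: (@derive_along _ _ (fun s => s * (a == i)%:R)); first exact: op_coord_smooth.
  move=> s; rewrite /op_coord /= scaler0 carnot_op0x !mxE eqxx /=.
  by rewrite eq_sym.
have -> : (fun s : R => s * (a == i)%:R) = (fun s => (a == i)%:R *: s).
  by apply/funext => s; rewrite mulrC.
by apply: is_derive_eq; rewrite [LHS]mulr1.
Qed.

(** The derivative has nonpositive degree [weight i - weight a], hence is constant,
    and at the origin the group law is addition to first order. *)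
Lemma derive_left_op_coord i a p : (weight i <= weight a)%N ->
  'D_(left_unit a) (op_coord i) p = (a == i)%:R.
Proof.
move=> ia.
have hf := derive_left_homogeneous a (op_coord_smooth i) (@op_coord_homogeneous i).
rewrite (homogeneous_const p _ hf)//; last first.
  exact/smooth_continuous/smooth_derive/op_coord_smooth.
rewrite derive_left_op_coord0; case: eqVneq => [->|_]; last by rewrite mulr0.
by rewrite add0n subnn expr0 mulr1.
Qed.

Lemma derive_right_op_coord i a p : (weight i <= weight a)%N ->
  'D_(right_unit a) (op_coord i) p = (a == i)%:R.
Proof.
move=> ia.
have hf := derive_right_homogeneous a (op_coord_smooth i) (@op_coord_homogeneous i).
rewrite (homogeneous_const p _ hf)//; last first.
  exact/smooth_continuous/smooth_derive/op_coord_smooth.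
rewrite derive_right_op_coord0; case: eqVneq => [->|_]; last by rewrite mulr0.
by rewrite add0n subnn expr0 mulr1.
Qed.

(** By the mean value theorem along the segment from [(x, y)] to [(x', y')]: the
    derivatives in the directions of weight at least [weight i] are those of the
    addition, and the segment does not move in the other directions. *)
Lemma op_lower i x y x' y' :
  (forall a, (weight a < weight i)%N -> x 0 a = x' 0 a /\ y 0 a = y' 0 a) ->
  op x' y' 0 i - op x y 0 i = (x' 0 i - x 0 i) + (y' 0 i - y 0 i).
Proof.
move=> agree; have sf := op_coord_smooth i.
have [s _] := @mean_value_line R _ (op_coord i) (x, y) (x' - x, y' - y) 1
  (fun q => smooth_derivable sf).
rewrite scale1r mul1r (_ : (x, y) + _ = (x', y')); last first.
  by congr pair => /=; rewrite addrC subrK.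
set p := (x, y) + _ => E; rewrite [LHS]E.
rewrite derive_leftright//.
congr (_ + _).
  rewrite (bigD1 i)//= derive_left_op_coord// eqxx mulr1 !mxE [X in _ + X]big1 ?addr0// => a ai.
  have [wai|wia] := ltnP (weight a) (weight i).
    by rewrite !mxE (agree a wai).1 subrr mul0r.
  by rewrite derive_left_op_coord// (negbTE ai) mulr0.
rewrite (bigD1 i)//= derive_right_op_coord// eqxx mulr1 !mxE [X in _ + X]big1 ?addr0// => a ai.
have [wai|wia] := ltnP (weight a) (weight i).
  by rewrite !mxE (agree a wai).2 subrr mul0r.
by rewrite derive_right_op_coord// (negbTE ai) mulr0.
Qed.

Lemma op_lower0l i x y : (forall a, (weight a < weight i)%N -> x 0 a = 0) ->
  op x y 0 i = x 0 i + y 0 i.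
Proof.
move=> x0; have := @op_lower i 0 y x y; rewrite carnot_op0x subrr addr0 mxE subr0.
by move=> /(_ _)/eqP; rewrite subr_eq => /(_ _)/eqP -> // a /x0 ->; rewrite mxE.
Qed.

(** The coefficients of the bilinear part of the group law at the origin. *)
Definition structure_coef i a b : R :=
  'D_(left_unit a) ('D_(right_unit b) (op_coord i)) 0.

Lemma mixed_homogeneous i a b : homogeneous (weight b + weight a) (weight i)
  ('D_(left_unit a) ('D_(right_unit b) (op_coord i))).
Proof.
apply: derive_left_homogeneous; first exact/smooth_derive/op_coord_smooth.
exact: derive_right_homogeneous (op_coord_smooth i) (@op_coord_homogeneous i).
Qed.

Lemma structure_coef_neq0 i a b :
  structure_coef i a b != 0 -> (weight a + weight b)%N = weight i.
Proof.
apply: contra_neq_eq => ab.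
by apply: (homogeneous_at0 (@mixed_homogeneous i a b)); rewrite addnC.
Qed.

(** The second difference of the group law over the rectangle with opposite corners
    [0] and [(x, y)] is a sum of mixed derivatives in directions of weights at
    least [d] and [e]; in weight at most [d + e] these have nonpositive degree, hence
    are constants. *)
Lemma op_bilinear i (d e : nat) x y :
  (forall a, (weight a < d)%N -> x 0 a = 0) ->
  (forall a, (weight a < e)%N -> y 0 a = 0) -> (weight i <= d + e)%N ->
  op x y 0 i = x 0 i + y 0 i + \sum_a \sum_b x 0 a * y 0 b * structure_coef i a b.
Proof.
move=> xd ye ide; have sf := op_coord_smooth i.
have [s _ [t _]] := @second_difference R _ (op_coord i) 0 (0, y) (x, 0) 1 sf.
rewrite !scale1r !mul1r !add0r; set p := _ *: _ + _.
have -> : (0, y) + (x, 0) = (x, y) by congr pair; rewrite /= ?addr0 ?add0r.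
rewrite {1 2 3 4}/op_coord /= carnot_op0x carnot_opx0 carnot_opx0 mxE addr0.
rewrite -addrA -opprD => /eqP; rewrite subr_eq => /eqP ->; rewrite addrC [y _ _ + _]addrC.
congr (_ + _); rewrite derive_left; last exact: smooth_derive.
apply: eq_bigr => a _.
have -> : 'D_(0, y) (op_coord i) = (\sum_b (y 0 b *: 'D_(right_unit b) (op_coord i))).
  by apply/funext => q; rewrite derive_right// fct_sumE.
rewrite derive_sum; last first.
  by move=> b; apply: derivableZ; apply: smooth_derivable; exact: smooth_derive.
rewrite mulr_sumr; apply: eq_bigr => b _.
rewrite deriveZ; last by apply: smooth_derivable; exact: smooth_derive.
suff : x 0 a != 0 -> y 0 b != 0 ->
    'D_(left_unit a) ('D_(right_unit b) (op_coord i)) p = structure_coef i a b.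
  move: ('D_(left_unit a) _ p) (structure_coef i a b) => c c' E.
  have [->|xa] := eqVneq (x 0 a) 0; first by rewrite !mul0r.
  have [->|yb] := eqVneq (y 0 b) 0; first by rewrite scale0r mulr0 mul0r.
  by rewrite E// [LHS]mulrA.
move=> xa yb.
have da : (d <= weight a)%N by rewrite leqNgt; apply: contra xa => /xd ->.
have eb : (e <= weight b)%N by rewrite leqNgt; apply: contra yb => /ye ->.
have iab : (weight i <= weight b + weight a)%N.
  by rewrite (leq_trans ide)// addnC leq_add.
have cD := smooth_continuous (smooth_derive (left_unit a) (smooth_derive (right_unit b) sf)).
rewrite (homogeneous_const p cD (@mixed_homogeneous i a b) iab).
rewrite -/(structure_coef i a b).
have [->|/structure_coef_neq0 c0] := eqVneq (structure_coef i a b) 0.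
  by rewrite mulr0.
by rewrite -c0 addnC subnn expr0 mul1r.
Qed.

End group_law.

(** * Left-invariant vector fields and their brackets *)

Section slices.
Context {R : realType} {V V' W : normedModType R}.
Implicit Types f : V * V' -> W.

Lemma is_derive_slice f x y u : smooth f ->
  is_derive y u (fun z => f (x, z)) ('D_(0, u) f (x, y)).
Proof.
move=> sf; have df : derivable f (x, y) (0, u) by exact: smooth_derivable.
have E : (fun h : R => h^-1 *: (((fun z => f (x, z)) \o shift y) (h *: u) - f (x, y)))
    = (fun h : R => h^-1 *: ((f \o shift (x, y)) (h *: (0, u)) - f (x, y))).
  apply/funext => h /=; congr (_ *: (f _ - _)).
  by congr pair; rewrite /= scaler0 add0r.
by apply: DeriveDef; rewrite /derivable /derive E.
Qed.

Lemma is_derive_slice_left f x y u : smooth f ->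
  is_derive x u (fun z => f (z, y)) ('D_(u, 0) f (x, y)).
Proof.
move=> sf; have df : derivable f (x, y) (u, 0) by exact: smooth_derivable.
have E : (fun h : R => h^-1 *: (((fun z => f (z, y)) \o shift x) (h *: u) - f (x, y)))
    = (fun h : R => h^-1 *: ((f \o shift (x, y)) (h *: (u, 0)) - f (x, y))).
  apply/funext => h /=; congr (_ *: (f _ - _)).
  by congr pair; rewrite /= scaler0 add0r.
by apply: DeriveDef; rewrite /derivable /derive E.
Qed.

End slices.

Lemma is_derive_row {R : realType} (V : normedModType R) m (c : V -> 'rV[R]_m) (s v : V) (d : 'rV[R]_m) :
  (forall i, is_derive s v (fun t => c t 0 i) (d 0 i)) -> is_derive s v c d.
Proof.
move=> cd; have dc : derivable c s v.
  by apply/derivable_mxP => i j; rewrite ord1; have [] := cd j.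
apply: DeriveDef => //; rewrite derive_mx//; apply/rowP => i; rewrite mxE.
by have /@derive_val := cd i.
Qed.

Section left_invariant_fields.
Context {R : realType} {r : nat} {hr : (1 < r)%N} {ns : 'I_r -> nat}.
Variable G : carnotGroup R hr ns.
Local Notation n := (\sum_j ns j)%N.
Local Notation RG := 'rV[R]_n.
Local Notation P := (RG * RG)%type.
Local Notation op := (carnot_op G).
Implicit Types (x y u v w : RG) (p : P) (i j a b : 'I_n) (f : P -> R).

Lemma differentiable_slice f x y : smooth f -> differentiable (fun z => f (x, z)) y.
Proof.
move=> sf; apply: (@differentiable_comp _ _ _ _ (fun z => (x, z)) f).
  by apply: differentiable_pair.
exact: smooth_diff.
Qed.

Lemma differentiable_slice_left f x y : smooth f -> differentiable (fun z => f (z, y)) x.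
Proof.
move=> sf; apply: (@differentiable_comp _ _ _ _ (fun z => (z, y)) f).
  by apply: differentiable_pair.
exact: smooth_diff.
Qed.

(** The left-invariant field with value [u] at the origin. *)
Definition left_field u x : RG := \row_i 'D_(0, u) (op_coord G i) (x, 0).

Lemma left_fieldE u x i :
  left_field u x 0 i = \sum_m u 0 m * 'D_(right_unit m) (op_coord G i) (x, 0).
Proof. by rewrite mxE derive_right//; exact: op_coord_smooth. Qed.

Lemma left_field0 u : left_field u 0 = u.
Proof.
apply/rowP => i; rewrite left_fieldE (bigD1 i)//=.
have E m : 'D_(right_unit m) (op_coord G i) (0, 0) = (m == i)%:R.
  exact: derive_right_op_coord0.
rewrite E eqxx mulr1 [X in _ + X]big1 ?addr0// => m /negbTE mi.
by rewrite E mi mulr0.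
Qed.

Lemma left_field_lin (c : R) u v x :
  left_field (c *: u + v) x = c *: left_field u x + left_field v x.
Proof.
apply/rowP => i; transitivity (c * left_field u x 0 i + left_field v x 0 i).
  2: by rewrite [RHS]mxE [X in _ = X + _]mxE.
have lin (g : 'I_n -> R) : \sum_m (c *: u + v) 0 m * g m =
    c * (\sum_m u 0 m * g m) + \sum_m v 0 m * g m.
  rewrite [X in _ = X + _]mulr_sumr -big_split /=; apply: eq_bigr => m _.
  by rewrite !mxE mulrDl mulrA.
apply: etrans (left_fieldE (c *: u + v) x i) (etrans (lin _) _).
have add2 (a b a' b' : R) : a = a' -> b = b' -> c * a + b = c * a' + b' by move=> -> ->.
exact/esym/add2/left_fieldE/left_fieldE.
Qed.

Lemma is_derive_translate u x (s : R) y :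
  is_derive s 1 (fun t : R => op x (y + t *: u))
    (\row_i 'D_(0, u) (op_coord G i) (x, y + s *: u)).
Proof.
apply: is_derive_row => i; rewrite mxE.
have E (t : R) : (x, y) + t *: (0, u) = (x, y + t *: u) :> P.
  by congr pair; rewrite /= scaler0 addr0.
have := @is_derive_line R _ _ (op_coord G i) (x, y) (0, u) s.
rewrite E (_ : (fun t : R => _) = (fun t => op x (y + t *: u) 0 i)); last first.
  by apply/funext => t; rewrite E.
by apply; apply: smooth_derivable; exact: op_coord_smooth.
Qed.

Lemma is_derive_translate0 u x :
  is_derive (0 : R) 1 (fun t : R => op x (t *: u)) (left_field u x).
Proof.
have := is_derive_translate u x 0 0; rewrite scale0r addr0.
by rewrite (_ : (fun t : R => _) = (fun t => op x (t *: u)))//; apply/funext => t; rewrite add0r.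
Qed.

(** Both sides are the derivative at [t = 0] of [x o y o (t w)], by associativity. *)
Lemma left_field_invariant w x y i : left_field w (op x y) 0 i =
  \sum_m left_field w y 0 m * 'D_(right_unit m) (op_coord G i) (x, y).
Proof.
have sf := op_coord_smooth G i.
have d1 := is_derive_translate0 w (op x y).
have {}d1 : is_derive (0 : R) 1 (fun t : R => op (op x y) (t *: w) 0 i) (left_field w (op x y) 0 i).
  have [/derivable_mxP dc E] := d1; apply: DeriveDef; first exact: dc.
  by rewrite -E derive_mx ?mxE//; have [] := d1.
have := @is_derive_comp R _ _ (fun z => op_coord G i (x, z))
  (fun t : R => op y (t *: w)) 0 (left_field w y).
rewrite scale0r carnot_opx0 => /(_ (differentiable_slice _ _ sf) (is_derive_translate0 w y)).
rewrite (_ : _ \o _ = (fun t : R => op (op x y) (t *: w) 0 i)); last first.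
  by apply/funext => t; rewrite -carnot_opA.
move=> /@derive_val; have /@derive_val -> := d1 => ->.
by have /@derive_val -> := is_derive_slice x y (left_field w y) sf; rewrite derive_right.
Qed.

Lemma carnot_XE k : carnot_X G k = left_field (delta_mx 0 (tagnat.Rank (first_layer hr) k)).
Proof.
apply/funext => x; rewrite -{1}[x](carnot_opx0 G) carnot_X_left_invariant carnot_X0.
set u := delta_mx _ _; apply: derive_val; apply: is_derive_row => i; rewrite mxE.
by apply: (is_derive_slice x 0 u); exact: op_coord_smooth.
Qed.

Lemma derive_derive_right (v : P) f y p : smooth f ->
  'D_v ('D_(0, y) f) p = \sum_b y 0 b * 'D_v ('D_(right_unit b) f) p.
Proof.
move=> sf.
have -> : 'D_(0, y) f = (\sum_b (y 0 b *: 'D_(right_unit b) f)).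
  by apply/funext => q; rewrite derive_right// fct_sumE.
have df b q : derivable ('D_(right_unit b) f) q v.
  by apply: smooth_derivable; exact: smooth_derive.
rewrite derive_sum; last by move=> b; apply: derivableZ.
by apply: eq_bigr => b _; rewrite deriveZ.
Qed.

Definition structure_form u w : RG :=
  \row_m \sum_a \sum_b u 0 a * w 0 b * structure_coef G m a b.

Lemma structure_formE u w m :
  'D_(u, 0) ('D_(0, w) (op_coord G m)) 0 = structure_form u w 0 m.
Proof.
have sf := op_coord_smooth G m; rewrite mxE derive_left; last exact: smooth_derive.
apply: eq_bigr => a _; rewrite derive_derive_right// mulr_sumr.
by apply: eq_bigr => b _; rewrite mulrA.
Qed.

(** Along the curve [t |-> x o (t u)] the field [left_field w] is, by
    left-invariance, the image of [left_field w (t u)] under the differential of the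
    left translation by [x]; the product rule gives the two terms.  The second one
    is symmetric in [u] and [w] and disappears from the bracket. *)
Lemma derive_left_field u w x i :
  'D_(left_field u x) (left_field w) x 0 i =
    \sum_m structure_form u w 0 m * 'D_(right_unit m) (op_coord G i) (x, 0)
    + 'D_(0, u) ('D_(0, w) (op_coord G i)) (x, 0).
Proof.
have sf m := op_coord_smooth G m; have sw m := smooth_derive (0, w) (sf m).
have dw v z : is_derive z v (left_field w) (\row_m 'D_(v, 0) ('D_(0, w) (op_coord G m)) (z, 0)).
  apply: is_derive_row => m; rewrite mxE.
  have := is_derive_slice_left z 0 v (sw m).
  by rewrite (_ : (fun _ => _) = (fun t => left_field w t 0 m))//; apply/funext => t; rewrite mxE.
have /@derive_val -> := dw (left_field u x) x; rewrite mxE.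
have /@derive_val <- := is_derive_slice_left x 0 (left_field u x) (sw i).
pose g m := 'D_(right_unit m) (op_coord G i).
have sg m : smooth (g m) by exact: smooth_derive.
have := @is_derive_comp R _ _ (fun z => 'D_(0, w) (op_coord G i) (z, 0))
  (fun t : R => op x (t *: u)) 0 (left_field u x).
rewrite scale0r carnot_opx0.
move=> /(_ (differentiable_slice_left _ _ (sw i)) (is_derive_translate0 u x)) /@derive_val <-.
have -> : (fun z => 'D_(0, w) (op_coord G i) (z, 0)) \o (fun t : R => op x (t *: u)) =
    \sum_m (fun t : R => 'D_(0, w) (op_coord G m) (t *: u, 0)) * (fun t : R => g m (x, t *: u)).
  apply/funext => t /=; rewrite fct_sumE; have := left_field_invariant w x (t *: u) i.
  by rewrite mxE => ->; apply: eq_bigr => m _; rewrite mxE.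
have El (t : R) : (t *: u, 0) = 0 + t *: (u, 0) :> P.
  by rewrite add0r; congr pair; rewrite /= scaler0.
have Er (t : R) : (x, t *: u) = (x, 0) + t *: (0, u) :> P.
  by congr pair; rewrite /= ?scaler0 ?add0r ?addr0.
have dh m : is_derive (0 : R) 1
   ((fun t : R => 'D_(0, w) (op_coord G m) (t *: u, 0)) * (fun t : R => g m (x, t *: u)))
   (structure_form u w 0 m * g m (x, 0) + w 0 m * 'D_(0, u) (g m) (x, 0)).
  have d1 : is_derive (0 : R) 1 (fun t : R => 'D_(0, w) (op_coord G m) (t *: u, 0))
      (structure_form u w 0 m).
    have := @is_derive_line R _ _ ('D_(0, w) (op_coord G m)) 0 (u, 0) 0.
    rewrite scale0r addr0 structure_formE => /(_ (smooth_derivable (sw m))).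
    rewrite (_ : (fun t : R => 'D_(0, w) (op_coord G m) (t *: u, 0)) = 
      (fun t : R => 'D_(0, w) (op_coord G m) (0 + t *: (u, 0))))//.
    by apply/funext => t; rewrite -El.
  have d2 : is_derive (0 : R) 1 (fun t : R => g m (x, t *: u)) ('D_(0, u) (g m) (x, 0)).
    have := @is_derive_line R _ _ (g m) (x, 0) (0, u) 0.
    rewrite scale0r addr0 => /(_ (smooth_derivable (sg m))).
    rewrite (_ : (fun t : R => g m (x, t *: u)) = (fun t : R => g m ((x, 0) + t *: (0, u))))//.
    by apply/funext => t; rewrite -Er.
  refine (is_derive_eq (is_deriveM d1 d2) _).
  have -> : 'D_(0, w) (op_coord G m) (0 *: u, 0) = w 0 m.
    by rewrite scale0r -[in RHS](left_field0 w) mxE.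
  by rewrite scale0r addrC mulrC.
rewrite (@derive_val _ _ _ _ _ _ _ (is_derive_sum dh)) big_split /=; congr (_ + _).
by rewrite derive_derive_right.
Qed.

Definition lie_op u w : RG := structure_form u w - structure_form w u.

Lemma lie_bracket_left_field u w :
  lie_bracket (left_field u) (left_field w) = left_field (lie_op u w).
Proof.
apply/funext => x; apply/rowP => i.
transitivity ('D_(left_field u x) (left_field w) x 0 i - 'D_(left_field w x) (left_field u) x 0 i).
  by rewrite [LHS]mxE [X in _ + X]mxE.
have E1 := derive_left_field u w x i; have E2 := derive_left_field w u x i.
have E3 := schwarz (x, 0) (0, u) (0, w) (op_coord_smooth G i).
have E4 := left_fieldE (lie_op u w) x i.
have eq_sub (a b c d e : R) : a = c + d -> b = e -> forall d', d = d' -> a - b = (c + d') - e.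
  by move=> -> -> ? ->.
have bracket_sum (d : R) (g : 'I_n -> R) :
    (\sum_m structure_form u w 0 m * g m + d) - (\sum_m structure_form w u 0 m * g m + d)
    = \sum_m lie_op u w 0 m * g m.
  rewrite opprD addrACA subrr addr0 -sumrB; apply: eq_bigr => m _.
  by rewrite -mulrBl; congr (_ * _); rewrite !mxE.
exact: etrans (eq_sub _ _ _ _ _ E1 E2 _ E3) (etrans (bracket_sum _ _) (esym E4)).
Qed.

(** The Hormander condition, read at the origin, in terms of the Lie algebra
    structure carried by the tangent space there. *)
Lemma lie_op_generates (S : set RG) :
  (forall k, S (delta_mx 0 (tagnat.Rank (first_layer hr) k))) -> S 0 ->
  (forall (c : R) u v, S u -> S v -> S (c *: u + v)) ->
  (forall u v, S u -> S v -> S (lie_op u v)) -> forall u, S u.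
Proof.
move=> Sgen S0 Slin Sbr u.
have LieS Y : Lie (carnot_X G) Y -> exists2 v, S v & Y = left_field v.
  elim=> [k||c Y1 Y2 _ [v1 Sv1 ->] _ [v2 Sv2 ->]|Y1 Y2 _ [v1 Sv1 ->] _ [v2 Sv2 ->]].
  - by exists (delta_mx 0 (tagnat.Rank (first_layer hr) k)) => //; exact: carnot_XE.
  - exists 0 => //; apply/funext => x; apply/rowP => i; rewrite left_fieldE mxE.
    by apply/esym; apply: big1 => m _; rewrite mxE mul0r.
  - exists (c *: v1 + v2); first exact: Slin.
    by apply/funext => x; rewrite left_field_lin.
  - by exists (lie_op v1 v2); [exact: Sbr|exact: lie_bracket_left_field].
have [Y [LY rkY]] := carnot_hormander G 0.
have SY i : S (Y i 0) by have [v Sv ->] := LieS _ (LY i); rewrite left_field0.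
have /submxP[D ->] : (u <= \matrix_i Y i 0)%MS by apply: submx_full; rewrite /row_full rkY.
rewrite mulmx_sum_row; apply: (big_ind S) => // [x y Sx Sy|i _].
  by rewrite -[x]scale1r; exact: Slin.
by rewrite rowK -[_ *: _]addr0; exact: Slin.
Qed.

End left_invariant_fields.

(** * Triangular systems of equations *)

Section triangular_fixpoint.
Variables (T : Type) (n : nat) (F : ('I_n -> T) -> 'I_n -> T).
Hypothesis F_tri : forall (i : 'I_n) f g, (forall a : 'I_n, (a < i)%N -> f a = g a) -> F f i = F g i.

(** Iterating [k] times stabilises the first [k] components. *)
Lemma triangular_fixpoint (f0 : 'I_n -> T) : exists f, forall i, F f i = f i.
Proof.
have stable k (i : 'I_n) : (i < k)%N -> iter k.+1 F f0 i = iter k F f0 i.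
  elim: k i => // k IH i ik; apply: F_tri => a ai; apply: IH.
  by rewrite (leq_trans ai).
by exists (iter n F f0) => i; exact: (stable n i (ltn_ord i)).
Qed.

End triangular_fixpoint.

(** * Concatenation and reversal of horizontal curves *)

Section lipschitz_curves.
Context {R : realType}.

Definition lipschitz_on {V : normedModType R} (a b : R) (f : R -> V) :=
  exists2 K : R, 0 <= K & forall s t, a <= s <= b -> a <= t <= b ->
    `|f s - f t| <= K * `|s - t|.

Lemma lipschitz_absolutely_continuous {V : normedModType R} (a b : R) (f : R -> V) :
  lipschitz_on a b f -> absolutely_continuous_on a b f.
Proof.
move=> [K K0 Kf] e e0; exists (e / (K + 1)); first by rewrite divr_gt0// ltr_wpDl.
move=> m u v uv _ sd.
have K1 : 0 < K + 1 by rewrite ltr_wpDl.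
apply: (@le_lt_trans _ _ ((K + 1) * \sum_(i < m) (v i - u i))).
  rewrite mulr_sumr; apply: ler_sum => i _; have [au [uvi vb]] := uv i.
  apply: le_trans (Kf _ _ _ _) _; rewrite ?au ?vb ?(le_trans uvi) ?(le_trans au)//.
  by rewrite ger0_norm ?subr_ge0// ler_wpM2r ?subr_ge0// lerDl.
by rewrite mulrC -ltr_pdivlMr.
Qed.

Lemma C1_lipschitz (f df : R -> R) (T : R) : (forall t : R, is_derive t 1 f (df t)) ->
  continuous df -> 0 <= T -> lipschitz_on 0 T f.
Proof.
move=> fd cdf T0.
have [c _ cmax] := EVT_max T0 (continuous_subspaceT (fun x => @cvg_norm _ _ _ _ _ _ _ (cdf x))).
exists `|df c| => // s t sT tT.
have cf : continuous f.
  by move=> x; apply: differentiable_continuous; apply/derivable1_diffP; have [] := fd x.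
wlog st : s t sT tT / t <= s.
  by move=> H; case/orP: (le_total t s) => ?; last rewrite distrC [`|s - t|]distrC; exact: H.
have [x] := MVT_segment st (fun x _ => fd x) (continuous_subspaceT cf).
rewrite in_itv /= => /andP[tx xs] ->; rewrite normrM ler_wpM2r// cmax// in_itv /=.
by move: sT tT => /andP[_ sT] /andP[t0 _]; rewrite (le_trans t0)// (le_trans xs).
Qed.

Lemma lipschitz_row m (a b : R) (f : R -> 'rV[R]_m) :
  (forall i, lipschitz_on a b (fun t => f t 0 i)) -> lipschitz_on a b f.
Proof.
move=> /(_ _)/cid2 H; pose K i := projT1 (H i).
have K0 i : 0 <= K i by rewrite /K; case: (H i).
exists (\sum_i K i); first exact: sumr_ge0.
move=> s t sab tab; have S0 : 0 <= (\sum_i K i) * `|s - t| by rewrite mulr_ge0 ?sumr_ge0.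
rewrite [leLHS]/Num.Def.normr/= mx_normrE; apply: bigmax_le => // -[i j] _ /=.
rewrite !mxE ord1; apply: (@le_trans _ _ (K j * `|s - t|)).
  by rewrite /K; case: (H j) => ? /= _; apply.
by rewrite ler_wpM2r// (bigD1 j)//= lerDl sumr_ge0.
Qed.

End lipschitz_curves.

Section horizontal_paths.
Context {R : realType} {r : nat} {hr : (1 < r)%N} {ns : 'I_r -> nat}.
Variable G : carnotGroup R hr ns.
Local Notation n := (\sum_j ns j)%N.
Local Notation RG := 'rV[R]_n.
Local Notation op := (carnot_op G).
Local Notation inv := (carnot_inv G).
Local Notation controls := ('I_(ns (first_layer hr)) -> R -> R).
Implicit Types (x y z u v : RG) (i j : 'I_n) (k : 'I_(ns (first_layer hr))).

Definition controlled_at (gamma : R -> RG) (a : controls) (t : R) :=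
  is_derive t 1 gamma (\sum_k a k t *: carnot_X G k (gamma t)) /\
  \sum_k a k t ^+ 2 <= 1.

(** Lipschitz curves controlled outside finitely many times are closed under
    concatenation and reversal, and they suffice to bound [d_cc]. *)
Definition path_in (delta : R) x y := exists gamma : R -> RG,
  [/\ gamma 0 = x, gamma delta = y, lipschitz_on 0 delta gamma &
    exists (a : controls) (s : seq R), forall t, 0 <= t <= delta -> t \notin s ->
      controlled_at gamma a t].

Lemma d_cc_le (delta : R) x y : 0 < delta -> path_in delta x y ->
  (d_cc G x y <= delta%:E)%E.
Proof.
move=> delta0 [gamma [g0 gd gl [a [s sP]]]]; apply: ereal_inf_lbound.
exists delta => //; split=> //; exists gamma; split=> //; split.
  exact: lipschitz_absolutely_continuous.
exists a; exists [set` s]; split.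
- apply: countable_measurable; first exact: measurable_set1.
  exact/finite_set_countable/finite_seq.
- exact/countable_lebesgue_measure0/finite_set_countable/finite_seq.
- move=> t /= nt; apply: contrapT => /negP nts; apply: nt => tdelta.
  exact: sP.
Qed.

Lemma path_rev (delta : R) x y : path_in delta x y -> path_in delta y x.
Proof.
move=> [gamma [g0 gd [K K0 gl] [a [s sP]]]].
have rev_in (t : R) : 0 <= t <= delta -> 0 <= delta - t <= delta.
  by move=> /andP[t0 td]; rewrite subr_ge0 td lerBlDr lerDl.
exists (fun t => gamma (delta - t)); split; rewrite ?subr0 ?subrr//.
  exists K => // t t' /rev_in td /rev_in td'; apply: le_trans (gl _ _ td td') _.
  by rewrite (_ : delta - t - (delta - t') = t' - t) 1?distrC//; ring.
exists (fun k t => - a k (delta - t)), [seq delta - t | t <- s] => t td ts.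
have [||dg a1] := sP (delta - t); first exact: rev_in.
  by apply: contra ts => tsm; apply/mapP; exists (delta - t) => //; rewrite opprB addrC subrK.
split; last by under eq_bigr do rewrite sqrrN.
have dc : is_derive t 1 (fun t : R => delta - t) (-1).
  have := is_deriveB (is_derive_cst delta t 1) (is_derive_id t 1).
  by rewrite sub0r.
have dgd : differentiable gamma (delta - t) by apply/derivable1_diffP; have [] := dg.
have := @is_derive_comp R _ _ gamma (fun t : R => delta - t) t (-1) dgd dc.
have -> : 'D_(-1) gamma (delta - t) = \sum_k - a k (delta - t) *: carnot_X G k (gamma (delta - t)).
  rewrite (_ : -1 = -1 *: (1 : R)); last by rewrite [RHS]mulr1.
  rewrite deriveZv//; have /@derive_val -> := dg.
  by rewrite scaleN1r -sumrN; apply: eq_bigr => k _; rewrite scaleNr.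
by [].
Qed.

Lemma path_cat (d1 d2 : R) x y z : 0 < d1 -> 0 < d2 ->
  path_in d1 x y -> path_in d2 y z -> path_in (d1 + d2) x z.
Proof.
move=> d10 d20 [g1 [g10 g1d [K1 K10 l1] [a1 [s1 P1]]]] [g2 [g20 g2d [K2 K20 l2] [a2 [s2 P2]]]].
pose g t := if t <= d1 then g1 t else g2 (t - d1).
exists g; split.
- by rewrite /g ltW.
- by rewrite /g leNgt ltrDl d20 /= addrAC subrr add0r.
- exists (K1 + K2); first exact: addr_ge0.
  move=> s t sd td; wlog st : s t sd td / s <= t.
    by move=> H; case/orP: (le_total s t) => ?; last rewrite distrC [`|s - t|]distrC; exact: H.
  move: sd td => /andP[s0 sd] /andP[t0 td]; rewrite /g.
  case: (leP t d1) => td1.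
    rewrite (le_trans st td1) (le_trans (l1 _ _ _ _))// ?s0 ?t0 ?(le_trans st)//.
    by rewrite ler_wpM2r// lerDl.
  case: (leP s d1) => sd1; last first.
    have E : s - d1 - (t - d1) = s - t by rewrite opprB addrA subrK.
    rewrite (le_trans (l2 _ _ _ _)) ?subr_ge0 ?(ltW sd1) ?(ltW td1)//= ?lerBlDl//.
    by rewrite E ler_wpM2r// lerDr.
  rewrite distrC -(subrKA y) (le_trans (ler_normD _ _))//.
  rewrite -{1}g20 -g1d [`|s - t|]distrC (_ : t - s = (t - d1) + (d1 - s)); last by rewrite subrKA.
  have t1 : 0 <= t - d1 by rewrite subr_ge0 ltW.
  have t2 : 0 <= d1 - s by rewrite subr_ge0.
  rewrite [`|t - d1 + _|]ger0_norm; last exact: addr_ge0.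
  rewrite [leRHS]mulrDr lerD//.
    rewrite (le_trans (l2 _ _ _ _)) ?t1 ?lerBlDl ?lexx ?(ltW d20)//=.
    by rewrite subr0 ger0_norm// ler_wpM2r// lerDr.
  rewrite (le_trans (l1 _ _ _ _)) ?s0 ?sd1 ?lexx ?(ltW d10)//.
  by rewrite ger0_norm// ler_wpM2r// lerDl.
exists (fun k t => if t <= d1 then a1 k t else a2 k (t - d1)),
  (d1 :: s1 ++ [seq t + d1 | t <- s2]) => t /andP[t0 td].
rewrite inE mem_cat !negb_or => /and3P[tnd1 ts1 ts2].
rewrite /controlled_at; case: ltgtP tnd1 => // td1 _.
- have [|//|dg A1] := P1 t; first by rewrite t0 ltW.
  rewrite {2}/g (ltW td1); split=> //.
  apply: near_eq_is_derive dg.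
  near=> u; rewrite /g ltW//; near: u; exact: lt_nbhsl.
- have [||dg A1] := P2 (t - d1); first by rewrite subr_ge0 ltW//= lerBlDl.
    by apply: contra ts2 => m; apply/mapP; exists (t - d1) => //; rewrite subrK.
  rewrite {2}/g leNgt td1 /=; split=> //.
  have dc : is_derive t 1 (fun t : R => t - d1) 1.
    have := is_deriveB (is_derive_id t 1) (is_derive_cst d1 t 1).
    by rewrite subr0.
  have dgd : differentiable g2 (t - d1) by apply/derivable1_diffP; have [] := dg.
  have := @is_derive_comp R _ _ g2 (fun t : R => t - d1) t 1 dgd dc; have /@derive_val -> := dg.
  apply: near_eq_is_derive.
  near=> u; rewrite /g /= leNgt (_ : d1 < u)//; near: u; exact: lt_nbhsr.
Unshelve. all: by end_near. Qed.

End horizontal_paths.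

(** * Words in the horizontal flows *)

Section words.
Context {R : realType} {r : nat} {hr : (1 < r)%N} {ns : 'I_r -> nat}.
Variable G : carnotGroup R hr ns.
Local Notation n := (\sum_j ns j)%N.
Local Notation RG := 'rV[R]_n.
Local Notation op := (carnot_op G).
Local Notation inv := (carnot_inv G).
Implicit Types (x y z u v h c : RG) (i j a b : 'I_n) (k : 'I_(ns (first_layer hr))).

Definition first_unit k : RG := delta_mx 0 (tagnat.Rank (first_layer hr) k).

Lemma weight_first k : weight (tagnat.Rank (first_layer hr) k) = 1%N.
Proof. by rewrite /weight tagnat.Rank1K. Qed.

Lemma left_field_lower u x y i : (forall a, (weight a < weight i)%N -> x 0 a = y 0 a) ->
  left_field G u x 0 i = left_field G u y 0 i.
Proof.
move=> xy; rewrite !mxE.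
have sf := op_coord_smooth G i.
have /@derive_val <- := is_derive_slice x 0 u sf.
have d2 := is_derive_slice y 0 u sf.
have E : (fun z => op_coord G i (x, z)) =
    (fun z => op_coord G i (y, z)) + cst (x 0 i - y 0 i).
  apply/funext => z; have := @op_lower _ _ _ _ G i y z x z.
  rewrite subrr addr0 => <-; last by move=> a /xy->.
  by rewrite !fctE /op_coord /= addrC subrK.
rewrite E.
have := is_deriveD d2 (is_derive_cst (x 0 i - y 0 i) 0 u).
by move=> /@derive_val ->; rewrite addr0.
Qed.

(** The fields [X_k] have degree 1. *)
Lemma left_field_dilation k (t : R) c i : 0 < t ->
  t * left_field G (first_unit k) (dilation t c) 0 i =
  t ^+ weight i * left_field G (first_unit k) c 0 i.
Proof.
move=> t0; have hf := derive_right_homogeneous (tagnat.Rank (first_layer hr) k)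
  (op_coord_smooth G i) (@op_coord_homogeneous _ _ _ _ G i).
have := hf t t0 (c, 0); rewrite weight_first add0n expr1 /dilation2 /= dilation0.
by rewrite !mxE.
Qed.

(** Self-similarity forces the integral curve of [X_k] from the origin to be
    [t |-> dilation t c]; at [t = 1] its equation reads [weight i * c_i = X_k(c)_i],
    which determines [c] as [X_k(c)_i] only involves coordinates of smaller weight. *)
Definition flow_direction k c :=
  forall i, left_field G (first_unit k) c 0 i / (weight i)%:R = c 0 i.

Lemma flow_direction_ex k : exists c, flow_direction k c.
Proof.
pose F (f : 'I_n -> R) (i : 'I_n) :=
  left_field G (first_unit k) (\row_a f a) 0 i / (weight i)%:R.
have [||f Ff] := @triangular_fixpoint R n F; last 1 first.
- exists (\row_a f a) => i; rewrite [RHS]mxE -Ff //.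
- move=> i f g fg; rewrite /F (@left_field_lower _ _ (\row_a g a))// => a ai.
  by rewrite !mxE; apply: fg; exact: weight_ltW ai.
- exact: (fun=> 0).
Qed.

(** Differentiate [t |-> x o dilation t c] by left-invariance and use that [X_k] has
    degree 1. *)
Lemma flow_path k c (t : R) x : flow_direction k c -> 0 < t ->
  path_in G t x (op x (dilation t c)).
Proof.
move=> cP t0; pose gamma s := op x (dilation s c).
pose dc (s : R) : RG := \row_m (c 0 m * ((weight m)%:R * s ^+ (weight m).-1)).
have dcP (s : R) : is_derive s 1 (fun s => dilation s c) (dc s).
  apply: is_derive_row => m; rewrite mxE.
  have -> : (fun s => dilation s c 0 m) = (c 0 m *: (fun s : R => s ^+ weight m)).
    by apply/funext => u; rewrite dilationE mulrC.
  apply: is_deriveZ; apply: DeriveDef; first exact: exprn_derivable.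
  by rewrite exp_derive [LHS]mulr1.
have dgP i (s : R) : is_derive s 1 (fun s => gamma s 0 i)
    (\sum_m dc s 0 m * 'D_(right_unit m) (op_coord G i) (x, dilation s c)).
  have sf := op_coord_smooth G i.
  have := is_derive_comp (differentiable_slice x (dilation s c) sf) (dcP s).
  have /@derive_val -> := is_derive_slice x (dilation s c) (dc s) sf.
  by rewrite derive_right.
have cdil : continuous (fun s => dilation s c).
  by move=> s; apply: differentiable_continuous; apply/derivable1_diffP; have [] := dcP s.
exists gamma; split => //.
- rewrite /gamma (_ : dilation 0 c = 0) ?carnot_opx0//.
  by apply/rowP => i; rewrite dilationE expr0n mul0r mxE.
- apply: lipschitz_row => i; apply: (C1_lipschitz (dgP i)); last exact: ltW.
  move=> s; apply: cvg_sumr => m _; apply: cvgM.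
    have -> : (fun s => dc s 0 m) = (fun s => c 0 m * ((weight m)%:R * s ^+ (weight m).-1)).
      by apply/funext => u; rewrite mxE.
    by rewrite mxE; apply: cvgMl_tmp; apply: cvgMl_tmp; exact: exprn_continuous.
  have cD := smooth_continuous (smooth_derive (right_unit m) (op_coord_smooth G i)).
  apply: (@continuous_comp _ _ _ (fun s => (x, dilation s c)) ('D_(right_unit m) (op_coord G i))).
    exact: (cvg_pair (cvg_cst x) (cdil s)).
  exact: cD.
(* The scaling of [X_k] is only available for positive times, so that time 0 is
   put among the exceptional ones. *)
exists (fun k' _ => (k' == k)%:R), [:: 0] => s /andP[s0 _]; rewrite inE => sn0.
have {sn0} sp : 0 < s by rewrite lt_neqAle eq_sym sn0.
split; last first.
  rewrite (bigD1 k)//= eqxx expr1n [X in _ + X]big1 ?addr0// => k' /negbTE ->.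
  by rewrite expr0n.
have -> : \sum_k0 (k0 == k)%:R *: carnot_X G k0 (gamma s) = carnot_X G k (gamma s).
  rewrite (bigD1 k)//= eqxx scale1r [X in _ + X]big1 ?addr0// => k' /negbTE ->.
  by rewrite scale0r.
apply: is_derive_row => i; rewrite carnot_XE left_field_invariant.
have := dgP i s; congr (is_derive _ _ _ _); apply: eq_bigr => m _; congr (_ * _).
have sn0 : s != 0 by rewrite gt_eqF.
apply: (mulfI sn0); rewrite left_field_dilation// mxE mulrCA [s * _]mulrCA -exprS.
have wm : (weight m)%:R != 0 :> R by rewrite pnatr_eq0.
by rewrite -[X in X * _ = _]cP mulrA divfK// mulrC.
Qed.

(** Right multiplication by a word of duration [delta] moves every point along a
    horizontal path of duration [delta]; words moreover inherit the dilations. *)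
Inductive word : R -> RG -> Prop :=
| word_flow k c (t : R) : flow_direction k c -> 0 < t -> word t (dilation t c)
| word_inv (d : R) u : word d u -> word d (inv u)
| word_mul (d1 d2 : R) u v : word d1 u -> word d2 v -> word (d1 + d2) (op u v).

Lemma word_gt0 (d : R) u : word d u -> 0 < d.
Proof. by elim=> // d1 d2 ? ? _ ? _ ?; exact: addr_gt0. Qed.

Lemma word_path (d : R) u x : word d u -> path_in G d x (op x u).
Proof.
move=> wu; elim: wu x => [k c t cP t0 x|d' v _ IH x|d1 d2 v v' w1 IH1 w2 IH2 x].
- exact: flow_path cP t0.
- apply: path_rev; rewrite -{2}[x](carnot_opx0 G) -(carnot_opVx G v) carnot_opA.
  exact: IH.
- rewrite carnot_opA; by apply: path_cat (IH1 x) (IH2 _); [exact: word_gt0 w1|exact: word_gt0 w2].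
Qed.

Lemma dilation_op (l : R) x y : 0 < l -> dilation l (op x y) = op (dilation l x) (dilation l y).
Proof. by move=> l0; exact: carnot_dilationM. Qed.

Lemma op_injl x y z : op x y = op x z -> y = z.
Proof.
move=> E; rewrite -[y](carnot_op0x G) -(carnot_opVx G x) -carnot_opA E carnot_opA.
by rewrite carnot_opVx carnot_op0x.
Qed.

Lemma dilation_inv (l : R) x : 0 < l -> dilation l (inv x) = inv (dilation l x).
Proof.
move=> l0; apply: (@op_injl (dilation l x)).
by rewrite -dilation_op// !carnot_opxV dilation0.
Qed.

Lemma word_dilation (l d : R) u : 0 < l -> word d u -> word (l * d) (dilation l u).
Proof.
move=> l0; elim=> [k c t cP t0|d' v _ IH|d1 d2 v v' _ IH1 _ IH2].
- by rewrite dilationM; apply: word_flow cP _; exact: mulr_gt0.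
- by rewrite dilation_inv//; exact: word_inv.
- by rewrite dilation_op// mulrDr; exact: word_mul.
Qed.

Lemma inv_lower h i : (forall a, (weight a < weight i)%N -> h 0 a = 0) ->
  inv h 0 i = - h 0 i.
Proof.
move=> h0; have := op_lower0l G (inv h) h0; rewrite carnot_opxV mxE => /esym/eqP.
by rewrite addrC addr_eq0 => /eqP.
Qed.

(** * Leading parts of words *)

(** Only the weight-[d] coordinates of [u] matter, so that the same vector can be
    tested in all weights at once, as the Hormander condition requires. *)
Definition leads (d : nat) u := exists delta h, word delta h /\
  forall i, (weight i <= d)%N -> h 0 i = if weight i == d then u 0 i else 0.

Lemma leads_eq d u v : (forall i, weight i = d -> u 0 i = v 0 i) -> leads d u -> leads d v.
Proof.
move=> uv [delta [h [wh hP]]]; exists delta, h; split=> // i id.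
by rewrite hP//; case: eqP => // /uv.
Qed.

Lemma leadsD d u v : leads d u -> leads d v -> leads d (u + v).
Proof.
move=> [d1 [h1 [w1 P1]]] [d2 [h2 [w2 P2]]]; exists (d1 + d2), (op h1 h2).
split=> [|i id]; first exact: word_mul.
rewrite op_lower0l ?P1 ?P2//.
  by case: eqP => _; rewrite ?mxE// addr0.
move=> a ai; have ad := leq_trans ai id.
by rewrite P1 ?(ltnW ad)//; case: eqP ad => // ->; rewrite ltnn.
Qed.

Lemma leadsN d u : leads d u -> leads d (- u).
Proof.
move=> [d1 [h1 [w1 P1]]]; exists d1, (inv h1); split=> [|i id]; first exact: word_inv.
rewrite inv_lower ?P1//; first by case: eqP => _; rewrite ?mxE// oppr0.
move=> a ai; have ad := leq_trans ai id.
by rewrite P1 ?(ltnW ad)//; case: eqP ad => // ->; rewrite ltnn.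
Qed.

Lemma leads0 d : leads d 0.
Proof.
have k : 'I_(ns (first_layer hr)) by apply: Ordinal (carnot_layers_gt0 G (first_layer hr)).
have [c cP] := flow_direction_ex k.
exists (1 + 1), (op (dilation 1 c) (inv (dilation 1 c))).
split=> [|i _]; last by rewrite carnot_opxV mxE; case: eqP.
by apply: word_mul; [|apply: word_inv]; exact: word_flow cP ltr01.
Qed.

(** The dilation by [pos_root d s] scales the coordinates of weight [d] by [`|s|]. *)
Definition pos_root (d : nat) (s : R) : R := `|s| `^ d%:R^-1.

Lemma pos_rootX d s : (0 < d)%N -> pos_root d s ^+ d = `|s|.
Proof.
move=> d0; rewrite -powR_mulrn ?powR_ge0// -powRrM mulVf ?powRr1//.
by rewrite pnatr_eq0 -lt0n.
Qed.

Lemma pos_root_gt0 d s : s != 0 -> 0 < pos_root d s.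
Proof. by move=> s0; rewrite powR_gt0// normr_gt0. Qed.

Lemma leadsZ d u (a : R) : (0 < d)%N -> leads d u -> leads d (a *: u).
Proof.
move=> d0; wlog a0 : a u / 0 < a.
  move=> H Lu; case: (ltgtP a 0) => [a0|a0|->].
  - rewrite -[a]opprK scaleNr; apply: leadsN; apply: H => //; by rewrite oppr_gt0.
  - exact: H.
  - by rewrite scale0r; exact: leads0.
move=> [d1 [h1 [w1 P1]]]; have s0 := pos_root_gt0 d (lt0r_neq0 a0).
exists (pos_root d a * d1), (dilation (pos_root d a) h1); split=> [|i id].
  exact: word_dilation.
rewrite dilationE P1//; case: eqP => [->|_]; last by rewrite mulr0.
by rewrite pos_rootX// gtr0_norm// mxE.
Qed.

Definition part (d : nat) u : RG := \row_i if weight i == d then u 0 i else 0.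

Lemma structure_form_part d e u v i : weight i != (d + e)%N ->
  structure_form G (part d u) (part e v) 0 i = 0.
Proof.
move=> ide; rewrite mxE; apply: big1 => a _; apply: big1 => b _; rewrite !mxE.
case: eqP => [ad|_]; last by rewrite !mul0r.
case: eqP => [be|_]; last by rewrite mulr0 mul0r.
have [->|/structure_coef_neq0 ab] := eqVneq (structure_coef G i a b) 0; first by rewrite mulr0.
by rewrite -ab ad be eqxx in ide.
Qed.

(** The commutator [c] of two words [h] and [k] solves [c o (k o h) = h o k].  The
    terms of weight at most [d + e] in [h o k] and [k o h] differ by the
    antisymmetrised bilinear part of the group law, so that [c] starts in weight
    [d + e], with the bracket of the leading parts. *)
Lemma leads_bracket d e u v : leads d u -> leads e v ->
  leads (d + e) (lie_op G (part d u) (part e v)).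
Proof.
move=> [d1 [h [wh hP]]] [d2 [k [wk kP]]].
have low (m : nat) (g w : RG) (gP : forall i, (weight i <= m)%N -> g 0 i = if weight i == m then w 0 i else 0) a :
    (weight a < m)%N -> g 0 a = 0.
  by move=> am; rewrite gP ?(ltnW am)// ltn_eqF.
have term (m m' : nat) (g g' w w' : RG)
  (gP : forall i, (weight i <= m)%N -> g 0 i = if weight i == m then w 0 i else 0)
  (gP' : forall i, (weight i <= m')%N -> g' 0 i = if weight i == m' then w' 0 i else 0) i :
  (weight i <= m + m')%N -> op g g' 0 i =
    g 0 i + g' 0 i + structure_form G (part m w) (part m' w') 0 i.
  move=> im; rewrite (op_bilinear G (low _ _ _ gP) (low _ _ _ gP') im); congr (_ + _).
  rewrite mxE; apply: eq_bigr => a _; apply: eq_bigr => b _; rewrite !mxE.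
  have [->|/structure_coef_neq0 ab] := eqVneq (structure_coef G i a b) 0.
    by rewrite !mulr0.
  congr (_ * _); case: (ltngtP (weight a) m) => [am|am|am].
  - by rewrite (low _ _ _ gP a am) !mul0r.
  - rewrite mul0r (low _ _ _ gP' b) ?mulr0//; move: im; rewrite -ab.
    by rewrite -(ltn_add2l m); apply: leq_trans; rewrite ltn_add2r.
  rewrite gP ?am// eqxx; congr (_ * _).
  have bm : (weight b <= m')%N by move: im; rewrite -ab am leq_add2l.
  by rewrite gP'//.
(* The commutator of [h] and [k]. *)
pose c := op (op h k) (inv (op k h)).
have cE : op c (op k h) = op h k by rewrite /c -carnot_opA carnot_opVx carnot_opx0.
have cP i : (weight i <= d + e)%N -> (forall a, (weight a < weight i)%N -> c 0 a = 0) ->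
    c 0 i = lie_op G (part d u) (part e v) 0 i.
  move=> ide c0; have := op_lower0l G (op k h) c0.
  rewrite cE (term _ _ _ _ _ _ hP kP)// (term _ _ _ _ _ _ kP hP) 1?addnC// => E.
  have {E} -> : c 0 i = h 0 i + k 0 i + structure_form G (part d u) (part e v) 0 i
      - (k 0 i + h 0 i + structure_form G (part e v) (part d u) 0 i) by rewrite E addrK.
  by rewrite /lie_op [RHS]mxE [X in _ = _ + X]mxE; ring.
have c0 i : (weight i < d + e)%N -> c 0 i = 0.
  have [m] := ubnP (weight i); elim: m i => // m IH i im ide.
  rewrite cP ?(ltnW ide)// => [|a ai].
    rewrite /lie_op mxE [X in _ + X]mxE !structure_form_part ?subrr// ?ltn_eqF//.
    by rewrite addnC.
  by rewrite IH// ?(leq_trans ai)//; exact: ltn_trans ide.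
exists (d1 + d2 + (d2 + d1)), c; split=> [|i ide].
  by apply: word_mul; [|apply: word_inv]; exact: word_mul.
case: eqP => [E|/eqP E]; last by apply: c0; rewrite ltn_neqAle E.
by apply: cP => // a; rewrite E; exact: c0.
Qed.

(** The bilinear part of the group law adds weights. *)
Lemma structure_form_split u v i : structure_form G u v 0 i =
  \sum_(d < (weight i).+1) structure_form G (part d u) (part (weight i - d) v) 0 i.
Proof.
transitivity (\sum_(d < (weight i).+1) \sum_a \sum_b
    part d u 0 a * part (weight i - d) v 0 b * structure_coef G i a b); last first.
  by apply: eq_bigr => d _; rewrite mxE.
rewrite mxE [RHS]exchange_big /=; apply: eq_bigr => a _.
rewrite [RHS]exchange_big /=; apply: eq_bigr => b _.
have [->|/structure_coef_neq0 ab] := eqVneq (structure_coef G i a b) 0.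
  by rewrite mulr0 [RHS]big1// => d _; rewrite mulr0.
have ai : (weight a < (weight i).+1)%N by rewrite ltnS -ab leq_addr.
have bi : (weight b == weight i - weight a)%N by rewrite -ab addKn.
rewrite (bigD1 (Ordinal ai))//= !mxE eqxx bi [X in _ + X]big1 ?addr0// => d.
rewrite -val_eqE /= => /negbTE da; rewrite !mxE eq_sym da.
by rewrite !mul0r.
Qed.

(** The weight-[d] part of a bracket is a sum of brackets of parts of weights [e] and
    [d - e], each of which is the leading part of a commutator. *)
Lemma leads_lie_op d u v : (forall d, (0 < d)%N -> leads d u) ->
  (forall d, (0 < d)%N -> leads d v) -> leads d (lie_op G u v).
Proof.
move=> Lu Lv.
have part0 w : part 0 w = 0 by apply/rowP => i; rewrite !mxE.
have form0 w : structure_form G 0 w = 0 /\ structure_form G w 0 = 0.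
  by split; apply/rowP => i; rewrite !mxE; apply: big1 => a _; apply: big1 => b _;
    rewrite mxE ?mulr0 !mul0r.
apply: (@leads_eq _ (\sum_(e < d.+1) lie_op G (part e u) (part (d - e) v))).
  move=> i id; rewrite summxE !mxE.
  transitivity (structure_form G u v 0 i - structure_form G v u 0 i); last by rewrite !mxE.
  rewrite (structure_form_split u) (structure_form_split v) id.
  rewrite [X in _ = _ - X](reindex_inj rev_ord_inj) /= -sumrB.
  apply: eq_bigr => e _; rewrite [LHS]mxE [X in _ + X]mxE; congr (_ - _).
  by rewrite subSS subKn// -ltnS.
apply: (big_ind (leads d)); [exact: leads0|exact: leadsD|move=> e _].
have ed : (e <= d)%N by rewrite -ltnS.
have [e0|e0] := posnP e.
  rewrite e0 part0 /lie_op; have [-> ->] := form0 (part (d - 0) v).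
  by rewrite subrr; exact: leads0.
have [de0|de0] := posnP (d - e).
  rewrite de0 part0 /lie_op; have [-> ->] := form0 (part e u).
  by rewrite subrr; exact: leads0.
by rewrite -{1}(subnKC ed); apply: leads_bracket; [exact: Lu|exact: Lv].
Qed.

(** In weight 1 the flow of [X_k] moves along [X_k(0)]; in the other weights the
    vector [X_k(0)] has no component, and a word equal to 0 serves. *)
Lemma leads_first_unit k d : (0 < d)%N -> leads d (first_unit k).
Proof.
move=> d0; have [->|d1] := eqVneq d 1%N; last first.
  apply: (leads_eq _ (leads0 d)) => i id; rewrite !mxE eqxx /=.
  by case: eqP => // ik; move: d1; rewrite -id ik weight_first eqxx.
have [c cP] := flow_direction_ex k.
exists 1, (dilation 1 c); split=> [|i i1]; first exact: word_flow cP ltr01.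
have {}i1 : weight i = 1%N by apply/eqP; rewrite eqn_leq i1.
rewrite dilation1 -cP i1 eqxx divr1 (@left_field_lower _ _ 0); last first.
  by move=> a; rewrite i1.
by rewrite left_field0.
Qed.

(** The vectors all of whose weighted parts are leading parts of words contain the
    [X_k(0)] and are stable under linear combinations and brackets, so that the
    Hormander condition applies. *)
Lemma leads_all d u : (0 < d)%N -> leads d u.
Proof.
move=> d0; pose S := [set u | forall d, (0 < d)%N -> leads d u].
suff : S u by exact.
apply: (lie_op_generates (G := G)) => [k e e0|e e0|a v w Sv Sw e e0|v w Sv Sw e e0].
- exact: leads_first_unit.
- exact: leads0.
- by apply: leadsD; [apply: leadsZ => //; exact: Sv|exact: Sw].
- exact: leads_lie_op.
Qed.

End words.

(** * Points near the origin are short words *)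

Section small_words.
Context {R : realType} {r : nat} {hr : (1 < r)%N} {ns : 'I_r -> nat}.
Variable G : carnotGroup R hr ns.
Local Notation n := (\sum_j ns j)%N.
Local Notation RG := 'rV[R]_n.
Local Notation op := (carnot_op G).
Local Notation inv := (carnot_inv G).
Implicit Types (x y z u v h c : RG) (i j a b : 'I_n).

Lemma inv0 : inv 0 = 0.
Proof. by rewrite -[RHS](carnot_opVx G 0) carnot_opx0. Qed.

Lemma inv_continuous : continuous inv.
Proof. exact: smooth_continuous (carnot_inv_smooth G). Qed.

Lemma op_cvg (T : Type) (F : set_system T) {FF : Filter F} (f g : T -> RG) x y :
  f t @[t --> F] --> x -> g t @[t --> F] --> y -> op (f t) (g t) @[t --> F] --> op x y.
Proof.
move=> fx gy.
apply: (@cvg_comp _ _ _ (fun t => (f t, g t)) (fun p : RG * RG => op p.1 p.2) _ (nbhs (x, y))).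
  exact: (cvg_pair fx gy).
have c := smooth_continuous (carnot_op_smooth G).
exact: (c (x, y)).
Qed.

Lemma pos_root_cvg0 d : (0 < d)%N -> pos_root d s @[s --> (0 : R)] --> (0 : R).
Proof.
move=> d0; apply/cvgrPdist_lt => eps eps0; near=> s.
rewrite sub0r normrN ger0_norm ?powR_ge0//.
rewrite -(ltr_pXn2r d0) ?nnegrE ?powR_ge0 ?(ltW eps0)// pos_rootX//.
near: s; have e0 : 0 < eps ^+ d by exact: exprn_gt0.
have /cvgrPdist_lt/(_ _ e0) := @cvg_id _ (nbhs (0 : R)).
by apply: filterS => s; rewrite sub0r normrN.
Unshelve. all: by end_near. Qed.

(** A word whose leading part is the [i]-th coordinate vector, and a dilation,
    adjust the [i]-th coordinate without disturbing the previous ones; their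
    cost is a root of the correction. *)
Lemma small_word_step i (delta : R) h : word G delta h ->
  (forall a, (weight a <= weight i)%N -> h 0 a = (a == i)%:R) ->
  exists2 g : R -> RG, g s @[s --> (0 : R)] --> (0 : RG) & forall s,
    (s != 0 -> word G (pos_root (weight i) s * delta) (g s)) /\
    (forall u, u 0 i = s -> (forall a, (a < i)%N -> u 0 a = 0) ->
       forall a, (a <= i)%N -> op (inv (g s)) u 0 a = 0).
Proof.
move=> wh hP; set d := weight i; have d0 : (0 < d)%N by exact: weight_gt0.
have ihP a : (weight a <= d)%N -> inv h 0 a = - (a == i)%:R.
  move=> ad; rewrite inv_lower ?hP// => b ba.
  have bd : (weight b < d)%N by exact: leq_trans ad.
  by rewrite hP ?(ltnW bd)//; case: eqP bd => // ->; rewrite ltnn.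
(* Dilations only scale by positive factors: a negative coordinate takes [inv h]. *)
pose g s := if 0 < s then dilation (pos_root d s) h else dilation (pos_root d s) (inv h).
have gE s a : (weight a <= d)%N -> g s 0 a = if a == i then s else 0.
  move=> ad; rewrite /g; case: ltP => s0; rewrite dilationE ?hP// ?ihP//.
    by case: eqP => [->|_]; rewrite ?mulr0// mulr1 pos_rootX// gtr0_norm.
  by case: eqP => [->|_]; rewrite ?oppr0 ?mulr0// mulrN1 pos_rootX// ler0_norm// opprK.
exists g.
  have gc v : dilation (pos_root d s) v @[s --> (0 : R)] --> (0 : RG).
    apply: (@cvg_comp _ _ _ (pos_root d) (fun l => dilation l v) _ (nbhs (0 : R))).
      exact: pos_root_cvg0.
    exact: dilation_cvg0.
  apply/cvgrPdist_lt => eps eps0.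
  have /cvgrPdist_lt/(_ _ eps0) H1 := gc h; have /cvgrPdist_lt/(_ _ eps0) H2 := gc (inv h).
  near=> s; rewrite /g; case: ifP => _; near: s; [exact: H1|exact: H2].
move=> s; split.
  move=> s0; have r0 := pos_root_gt0 d s0; rewrite /g.
  by case: ifP => _; apply: word_dilation => //; exact: word_inv.
move=> u us u0 a ai.
have ad : (weight a <= d)%N by exact: weight_le.
have glow b : (weight b < d)%N -> g s 0 b = 0.
  move=> bd; rewrite gE ?(ltnW bd)//; case: eqP bd => // ->; by rewrite ltnn.
have iglow b : (weight b <= d)%N -> inv (g s) 0 b = - (if b == i then s else 0).
  move=> bd; rewrite inv_lower ?gE// => b' b'b.
  by apply: glow; exact: leq_trans bd.
rewrite op_lower0l; last first.
  move=> b ba; have bd : (weight b < d)%N by exact: leq_trans ad.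
  by rewrite iglow ?(ltnW bd)//; case: eqP bd => [->|]; rewrite ?ltnn ?oppr0.
rewrite iglow//; case: eqP => [->|/eqP anei]; first by rewrite us addNr.
by rewrite oppr0 add0r u0// ltn_neqAle anei.
Unshelve. all: by end_near. Qed.

Lemma word0 (eps : R) : 0 < eps -> exists2 d, d <= eps & word G d 0.
Proof.
move=> eps0; have [d [h [wh _]]] := leads0 G 0.
have d0 := word_gt0 wh; have w0 : word G (d + d) 0.
  by rewrite -(carnot_opxV G h); apply: word_mul => //; exact: word_inv.
exists eps => //; have dd : 0 < d + d by exact: addr_gt0.
have := word_dilation (divr_gt0 eps0 dd) w0.
by rewrite divfK ?gt_eqF// dilation0.
Qed.

(** The ball-box phenomenon, qualitatively: the points close to the origin are
    reached by short words.  Coordinates are corrected one after the other. *)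
Lemma small_words (eps : R) : 0 < eps ->
  \forall u \near (0 : RG), exists2 d, d <= eps & word G d u.
Proof.
(* Induction on the number [m] of trailing coordinates that may be nonzero. *)
suff H m : (m <= n)%N -> forall e, 0 < e -> \forall u \near (0 : RG),
    (forall a : 'I_n, (a < n - m)%N -> (u : RG) 0 a = 0) -> exists2 d, d <= e & word G d u.
  move=> /(H n (leqnn n)); apply: filterS => u; apply => a.
  by rewrite subnn.
elim: m => [|m IH] mn e e0.
  near=> u => u0; have -> : u = 0.
    by apply/rowP => a; rewrite mxE u0// subn0.
  exact: word0.
have mlt : (n - m.+1 < n)%N by rewrite ltn_subrL /= (leq_ltn_trans _ mn).
pose i : 'I_n := Ordinal mlt; have e2 : 0 < e / 2 by rewrite divr_gt0.
have ism : (i.+1 = n - m)%N by rewrite /= subnSK.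
have [delta [h [wh hP]]] := leads_all G (delta_mx 0 i) (weight_gt0 i).
have {}hP a : (weight a <= weight i)%N -> h 0 a = (a == i)%:R.
  move=> ai; rewrite hP// mxE eqxx /=; case: eqP => // wai.
  by case: eqP => // E; move: wai; rewrite E.
have [g g0 gP] := small_word_step wh hP.
have coord0 : (u : RG) 0 i @[u --> (0 : RG)] --> (0 : R).
  have : (u : RG) 0 i @[u --> (0 : RG)] --> (0 : RG) 0 i by exact: coord_continuous.
  by rewrite mxE.
have gc : g ((u : RG) 0 i) @[u --> (0 : RG)] --> (0 : RG).
  exact: (cvg_comp _ g coord0).
have uc : op (inv (g ((u : RG) 0 i))) u @[u --> (0 : RG)] --> (0 : RG).
  have ic : inv (g ((u : RG) 0 i)) @[u --> (0 : RG)] --> inv 0.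
    by apply: (cvg_comp _ _ gc); exact: inv_continuous.
  have := @op_cvg _ _ _ (fun u : RG => inv (g (u 0 i))) (fun u => u) _ 0 ic cvg_id.
  have -> : op (inv 0) 0 = 0 by rewrite carnot_opx0 inv0.
  exact.
have IHe := IH (ltnW mn) e e0.
have IHe2 := uc _ (IH (ltnW mn) _ e2).
have rc : pos_root (weight i) ((u : RG) 0 i) * delta @[u --> (0 : RG)] --> (0 : R).
  have rc0 : pos_root (weight i) ((u : RG) 0 i) @[u --> (0 : RG)] --> (0 : R).
    by apply: (cvg_comp _ _ coord0); exact: pos_root_cvg0.
  have : pos_root (weight i) ((u : RG) 0 i) * delta @[u --> (0 : RG)] --> 0 * delta.
    exact: (cvgM rc0 (cvg_cst delta)).
  by rewrite mul0r.
have rce : \forall u \near (0 : RG), pos_root (weight i) ((u : RG) 0 i) * delta < e / 2.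
  have /cvgrPdist_lt/(_ _ e2) := rc; apply: filterS => u; rewrite sub0r normrN.
  by apply: le_lt_trans; exact: ler_norm.
near=> u => u0.
have [ui0|ui0] := eqVneq (u 0 i) 0.
  suff : forall a : 'I_n, (a < n - m)%N -> u 0 a = 0 by near: u.
  move=> a; rewrite -ism ltnS leq_eqVlt => /orP[/eqP ai|ai]; last exact: u0.
  by rewrite (_ : a = i)//; exact: val_inj.
have [/(_ ui0) wg low] := gP (u 0 i).
have [d de wd] : exists2 d, d <= e / 2 & word G d (op (inv (g (u 0 i))) u).
  suff : forall a : 'I_n, (a < n - m)%N -> op (inv (g (u 0 i))) u 0 a = 0.
    near: u; exact: IHe2.
  by move=> a; rewrite -ism ltnS => ai; exact: low.
exists (pos_root (weight i) (u 0 i) * delta + d).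
  rewrite (splitr e) lerD//; apply: ltW; near: u; exact: rce.
by have := word_mul wg wd; rewrite carnot_opA carnot_opxV carnot_op0x.
Unshelve. all: by end_near. Qed.

(** Chow's theorem, uniformly in [x]: a word can be run from any starting point. *)
Lemma d_cc_small (eps : R) : 0 < eps ->
  \forall u \near (0 : RG), forall x, (d_cc G x (op x u) <= eps%:E)%E.
Proof.
move=> eps0; have := small_words eps0; apply: filterS => u [d de wu] x.
apply: le_trans (d_cc_le (word_gt0 wu) (word_path x wu)) _.
by rewrite lee_fin.
Qed.

End small_words.

(** * Invariance of Lebesgue measure under shears *)

Section lebesgue_shear.
Context {R : realType}.

(** The translate of Lebesgue measure agrees with it on intervals. *)
Lemma lebesgue_measure_translate (c : R) (A : set R) : measurable A ->
  lebesgue_measure ((fun x : R => x + c) @^-1` A) = lebesgue_measure A.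
Proof.
move=> mA; have mc : measurable_fun [set: measurableTypeR R]
    ((fun x => x + c) : measurableTypeR R -> measurableTypeR R).
  by apply: measurable_funD => //; exact: measurable_cst.
apply/esym; apply: (@lebesgue_measure_unique R (pushforward lebesgue_measure
  ((fun x => x + c) : measurableTypeR R -> measurableTypeR R))) => //.
move=> _ [[a b]] _ <-.
transitivity (lebesgue_measure `]a - c, b - c]%classic); last first.
  congr lebesgue_measure; apply/seteqP.
  by split => x; rewrite /= !in_itv /= ltrBlDr lerBrDr.
rewrite /= !lebesgue_measure_itv /= !lte_fin ltrD2r.
by case: ifP => // _; rewrite -!EFinB opprB addrA subrK.
Qed.

Lemma uncons_rVK n (x : borel_rV R n.+1) : cons_rV (uncons_rV x) = x.
Proof.
rewrite /cons_rV /uncons_rV /=; apply: etrans (hsubmxK (x : 'rV_(1 + n))).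
congr (row_mx _ _); apply/rowP => i; rewrite !mxE ord1 /= mulr1n.
by congr (x _ _); exact/val_inj.
Qed.

Lemma cons_rV_rshift n (p : measurableTypeR R * borel_rV R n) (j : 'I_n) :
  (cons_rV p : 'rV[R]_n.+1) 0 (rshift 1 j) = (p.2 : 'rV[R]_n) 0 j.
Proof. exact: row_mxEr. Qed.

Lemma cons_rV0 n (p : measurableTypeR R * borel_rV R n) :
  (cons_rV p : 'rV[R]_n.+1) 0 0 = p.1.
Proof. by have := congr1 fst (cons_rVK p). Qed.

(** A unipotent lower triangular map, possibly nonlinear: the [i]-th coordinate of
    [T x] is [x_i] plus a function of the previous coordinates. *)
Definition shear n (T : 'rV[R]_n -> 'rV[R]_n) := forall (i : 'I_n) (x y : 'rV[R]_n),
  (forall a : 'I_n, (a < i)%N -> x 0 a = y 0 a) -> T x 0 i - x 0 i = T y 0 i - y 0 i.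

(** By Fubini: a shear translates the first coordinate by a constant, and acts on
    each slice with fixed first coordinate by a shear in one dimension less.  This
    uses no differentiability and no determinant. *)
Lemma lebesgue_rV_shear n (T : 'rV[R]_n -> 'rV[R]_n) (A : set (borel_rV R n)) :
  measurable_fun setT (T : borel_rV R n -> borel_rV R n) -> shear T -> measurable A ->
  lebesgue_rV R n (T @^-1` A) = lebesgue_rV R n A.
Proof.
elim: n T A => [|n IH] T A mT sT mA.
  congr (lebesgue_rV R 0 _); apply/seteqP; split => x /=;
    by rewrite (_ : T x = x)//; apply/rowP; case.
have mcons := @measurable_cons_rV R n.
pose B := @cons_rV R n @^-1` A.
have mB : measurable B by rewrite -[B]setTI; exact: mcons.
pose c := T 0 0 0.
have Tc x : T x 0 0 = x 0 0 + c.
  have := sT 0 x 0; rewrite [(0 : 'rV_n.+1) 0 0]mxE subr0 /c => <- //.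
  by rewrite addrC subrK.
pose Tx (x : R) (y : 'rV[R]_n) : 'rV[R]_n := (uncons_rV (T (cons_rV (x, y)))).2.
have TxE (x : R) y : T (cons_rV (x, y)) = cons_rV (x + c, Tx x y).
  rewrite -[LHS]uncons_rVK; congr cons_rV; rewrite [LHS]surjective_pairing.
  by congr pair; rewrite /uncons_rV /= Tc cons_rV0.
have mTx (x : R) : measurable_fun setT (Tx x : borel_rV R n -> borel_rV R n).
  apply: (measurableT_comp measurable_snd).
  apply: (measurableT_comp (@measurable_uncons_rV R n)).
  apply: (measurableT_comp mT); apply: (measurableT_comp mcons).
  exact: pair1_measurable.
have sTx (x : R) : shear (Tx x).
  move=> i y y' yy'.
  have := sT (rshift 1 i) (cons_rV (x, y)) (cons_rV (x, y')).
  rewrite !TxE !cons_rV_rshift /=; apply => a.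
  case: (splitP (a : 'I_(1 + n))) => j aj ai.
    rewrite (_ : a = 0); last by apply/val_inj; rewrite /= aj ord1.
    by rewrite !cons_rV0.
  rewrite (_ : a = rshift 1 j); last exact/val_inj.
  by rewrite !cons_rV_rshift; apply: yy'; move: ai; rewrite aj.
pose F x := lebesgue_rV R n (xsection B x).
have mF : measurable_fun setT F by exact: measurable_fun_xsection.
pose tr : measurableTypeR R -> measurableTypeR R := fun x => x + c.
have mtr : measurable_fun setT tr.
  by apply: measurable_funD => //; exact: measurable_cst.
transitivity (\int[lebesgue_measure]_x (F \o tr) x)%E.
  apply: eq_integral => x _ /=; rewrite /F -(IH (Tx x))//; last exact: measurable_xsection.
  congr (lebesgue_rV R n _); apply/seteqP; split => y; rewrite /xsection /= !inE /B /= TxE;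
  exact.
transitivity (\int[lebesgue_measure]_x F x)%E => //.
rewrite -[LHS](@ge0_integral_pushforward _ _ _ _ _ _ mtr lebesgue_measure setT F)//.
by apply: eq_measure_integral => S mS _; exact: lebesgue_measure_translate.
Qed.

Lemma ge0_integral_shear n (T : 'rV[R]_n -> 'rV[R]_n) (f : borel_rV R n -> \bar R) :
  measurable_fun setT (T : borel_rV R n -> borel_rV R n) -> shear T ->
  measurable_fun setT f -> (forall x, 0 <= f x)%E ->
  (\int[lebesgue_rV R n]_x f (T x) = \int[lebesgue_rV R n]_x f x)%E.
Proof.
move=> mT sT mf f0.
rewrite -[LHS](@ge0_integral_pushforward _ _ _ _ _ _ mT (lebesgue_rV R n) setT f)//.
by apply: eq_measure_integral => S mS _; exact: lebesgue_rV_shear.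
Qed.

End lebesgue_shear.

(** * Countable sums *)

Section countable_sums.
Local Open Scope ereal_scope.
Context {R : realType} {I : countType}.
Implicit Types a : I -> \bar R.

(** Sums over a countable type become series through [pickle]; the integers which
    code nothing contribute 0. *)
Definition enum_term {J : countType} (a : J -> \bar R) (m : nat) : \bar R := oapp a 0 (pickle_inv m).

Lemma enum_term_ge0 a m : (forall k, 0 <= a k) -> 0 <= enum_term a m.
Proof. by move=> a0; rewrite /enum_term; case: (pickle_inv m) => //= k. Qed.

Lemma esum_enum a : (forall k, 0 <= a k) ->
  \esum_(k in [set: I]) a k = \sum_(m <oo) enum_term a m.
Proof.
move=> a0; rewrite nneseries_esumT; last by move=> m; exact: enum_term_ge0.
have -> : \esum_(m in [set: nat]) enum_term a m =
    \esum_(m in range (@pickle I)) enum_term a m.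
  rewrite [RHS]esum_mkcond; apply: eq_esum => m _; case: ifPn => //.
  rewrite notin_setE => /= nm; rewrite /enum_term.
  case E : (pickle_inv m) => [k|//]; exfalso; apply: nm; exists k => //.
  by have := @pickle_invK I m; rewrite E.
rewrite (@esum_image _ _ _ setT pickle); last first.
  by move=> x y _ _; exact: (pcan_inj pickleK_inv).
by apply: eq_esum => k _; rewrite /enum_term pickleK_inv.
Qed.

Lemma esum_single a k0 : (forall k, 0 <= a k) -> (forall k, k != k0 -> a k = 0) ->
  \esum_(k in [set: I]) a k = a k0.
Proof.
move=> a0 ak; rewrite -[RHS](esum_set1 (a0 k0)) [RHS]esum_mkcond.
apply: eq_esum => k _; case: ifPn => //; rewrite notin_setE /= => kk0.
by apply: ak; apply/eqP.
Qed.

Lemma measurable_esum d (T : measurableType d) (f : I -> T -> \bar R) (D : set T) :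
  (forall k x, 0 <= f k x) -> (forall k, measurable_fun D (f k)) ->
  measurable_fun D (fun x => \esum_(k in [set: I]) f k x).
Proof.
move=> f0 mf.
have -> : (fun x => \esum_(k in [set: I]) f k x) =
    (fun x => \sum_(m <oo) enum_term (f ^~ x) m).
  by apply/funext => x; exact: esum_enum.
apply: ge0_emeasurable_sum => [m x _ _|m _]; first exact: enum_term_ge0.
by rewrite /enum_term; case: (pickle_inv m) => [k|] /=; [exact: mf|exact: measurable_cst].
Qed.

Lemma integral_esum d (T : measurableType d) (mu : {measure set T -> \bar R})
    (f : I -> T -> \bar R) (D : set T) : measurable D ->
  (forall k x, 0 <= f k x) -> (forall k, measurable_fun D (f k)) ->
  \int[mu]_(x in D) (\esum_(k in [set: I]) f k x) =
  \esum_(k in [set: I]) \int[mu]_(x in D) f k x.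
Proof.
move=> mD f0 mf; rewrite esum_enum; last by move=> k; exact: integral_ge0.
under eq_integral do rewrite esum_enum//.
rewrite integral_nneseries//.
- apply: eq_eseriesr => m _; rewrite /enum_term.
  by case: (pickle_inv m) => [k|] //=; rewrite integral0.
- by move=> m; rewrite /enum_term;
    case: (pickle_inv m) => [k|] /=; [exact: mf|exact: measurable_cst].
- by move=> m x _; exact: enum_term_ge0.
Qed.

End countable_sums.

(** * The unit cube as a fundamental domain of the lattice *)

Section borel_maps.
Context {R : realType}.

Lemma continuous_measurable_rV m n (f : 'rV[R]_m -> 'rV[R]_n) : continuous f ->
  measurable_fun setT (f : borel_rV R m -> borel_rV R n).
Proof.
move=> cf; apply: (measurability _ (erefl : @measurable _ (borel_rV R n) =
  <<s @open 'rV[R]_n >>)).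
move=> _ [U oU <-]; rewrite setTI; apply: measurable_open_rV.
by move/continuousP : cf; exact.
Qed.

End borel_maps.

Section lattice.
Context {R : realType} {r : nat} {hr : (1 < r)%N} {ns : 'I_r -> nat}.
Variable G : carnotGroup R hr ns.
Local Notation n := (\sum_j ns j)%N.
Local Notation RG := 'rV[R]_n.
Local Notation op := (carnot_op G).
Local Notation inv := (carnot_inv G).
Local Notation borelRG := (borel_rV R n).
Implicit Types (x y z : RG) (k l m : 'rV[int]_n).

(** The pair is turned into a row vector of length [n + n]: continuous maps of row
    vectors are Borel, and maps into row vectors can be tested on the coordinates. *)
Lemma measurable_op d (T : measurableType d) (f g : T -> borelRG) :
  measurable_fun setT f -> measurable_fun setT g ->
  measurable_fun setT ((fun t => op (f t) (g t)) : T -> borelRG).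
Proof.
move=> mf mg; pose h (z : 'rV[R]_(n + n)) : 'rV[R]_n := op (lsubmx z) (rsubmx z).
have ch : continuous h.
  move=> z; apply: (@op_cvg _ _ _ _ G _ _ (nbhs_filter z) (@lsubmx R 1 n n) (@rsubmx R 1 n n) (lsubmx z) (rsubmx z)).
    exact: continuous_lsubmx.
  exact: continuous_rsubmx.
pose j (t : T) : borel_rV R (n + n) := row_mx (f t : 'rV_n) (g t : 'rV_n).
have mj : measurable_fun setT j.
  apply: measurable_fun_rV => i; case: (splitP i) => a ia.
    rewrite (_ : (fun t => _) = fun t => (f t : RG) 0 a); last first.
      apply/funext => t; rewrite (_ : i = lshift n a); last exact/val_inj.
      exact: row_mxEl.
    exact: (measurableT_comp (@measurable_coord R n a) mf).
  rewrite (_ : (fun t => _) = fun t => (g t : RG) 0 a); last first.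
    apply/funext => t; rewrite (_ : i = rshift n a); last exact/val_inj.
    exact: row_mxEr.
  exact: (measurableT_comp (@measurable_coord R n a) mg).
rewrite (_ : (fun t => op (f t) (g t)) = h \o j).
  exact: (measurableT_comp (continuous_measurable_rV ch)).
by apply/funext => t; rewrite /h /j /= row_mxKl row_mxKr.
Qed.

Lemma measurable_inv d (T : measurableType d) (f : T -> borelRG) :
  measurable_fun setT f -> measurable_fun setT ((fun t => inv (f t)) : T -> borelRG).
Proof.
move=> mf; have cinv := smooth_continuous (carnot_inv_smooth G).
exact: (measurableT_comp (continuous_measurable_rV cinv) mf).
Qed.

Lemma shear_opl y : shear (op y).
Proof.
move=> i x x' xx'; apply/eqP; rewrite subr_eq -addrA addrC -subr_eq; apply/eqP.
have := @op_lower _ _ _ _ G i y x' y x; rewrite subrr add0r => -> .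
  by rewrite addrC.
by move=> a /weight_ltW/xx' ->.
Qed.

Lemma shear_opr y : shear (op^~ y).
Proof.
move=> i x x' xx'; apply/eqP; rewrite subr_eq -addrA addrC -subr_eq; apply/eqP.
have := @op_lower _ _ _ _ G i x' y x y; rewrite subrr addr0 => -> .
  by rewrite addrC.
by move=> a /weight_ltW/xx' ->.
Qed.

Lemma int_rV_inj : injective (@int_rV R n).
Proof.
by move=> k l /rowP kl; apply/rowP => i; have := kl i; rewrite !mxE => /intr_inj.
Qed.

(** Left translations by the lattice have the unit cube as a fundamental domain,
    as an integral translation can be found coordinate after coordinate. *)
Lemma cube_translate_ex x : exists k, cube (op (int_rV k) x).
Proof.
pose F (k : 'I_n -> int) (i : 'I_n) : int :=
  - Num.floor (op (int_rV (\row_a k a)) x 0 i - (k i)%:~R).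
have F_tri (i : 'I_n) (k l : 'I_n -> int) : (forall a : 'I_n, (a < i)%N -> k a = l a) -> F k i = F l i.
  move=> kl; rewrite /F; congr (- Num.floor _).
  have := @shear_opr x i (int_rV (\row_a k a)) (int_rV (\row_a l a)).
  by rewrite !mxE; apply=> a ai; rewrite !mxE kl.
have [k Fk] := triangular_fixpoint F_tri (fun=> 0).
exists (\row_a k a) => i; have := Fk i; rewrite /F => /eqP; rewrite eqr_oppLR => /eqP Fi.
have := floor_itv (op (int_rV (\row_a k a)) x 0 i - (k i)%:~R); rewrite Fi.
by rewrite rmorphN /= rmorphD rmorphN /= => /andP[]; rewrite lerBrDr addNr ltrBlDr addrAC addNr add0r => -> ->.
Qed.

(** Lattice points are compared coordinate after coordinate: once the previous
    coordinates agree, the current one is determined by an integral part. *)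
Lemma cube_translate_uniq x k l : cube (op (int_rV k) x) -> cube (op (int_rV l) x) -> k = l.
Proof.
move=> ck cl; apply/rowP => i; have [m] := ubnP (i : nat); elim: m i => // m IH i im.
have := @shear_opr x i (int_rV k) (int_rV l); rewrite !mxE => E.
have {}E : op (int_rV k) x 0 i - (k 0 i)%:~R = op (int_rV l) x 0 i - (l 0 i)%:~R.
  by apply: E => a ai; rewrite !mxE IH// (leq_trans ai).
have fl (p : 'rV[int]_n) : cube (op (int_rV p) x) ->
    Num.floor (op (int_rV p) x 0 i - (p 0 i)%:~R) = - p 0 i.
  move=> /(_ i)/andP[p0 p1]; apply: floor_def.
  have E1 : (- p 0 i)%:~R = - (p 0 i)%:~R :> R by exact: rmorphN.
  have E2 : (- p 0 i + 1)%:~R = - (p 0 i)%:~R + 1 :> R by rewrite intrD E1.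
  rewrite E2 E1; move: p0 p1 {E1 E2}.
  move: (op _ _ _ _) ((p 0 i)%:~R : R) => u v p0 p1.
  by apply/andP; split; lra.
by apply: oppr_inj; rewrite -fl// -fl// E.
Qed.

Lemma int_rV_inv k : Zn_subgroup G -> exists l, inv (int_rV k) = int_rV l.
Proof. by move=> [_ hinv]; exact: hinv. Qed.

Lemma invK x : inv (inv x) = x.
Proof. by apply: (@op_injl _ _ _ _ G (inv x)); rewrite carnot_opxV carnot_opVx. Qed.

Lemma opK x y : op (inv x) (op x y) = y.
Proof. by rewrite carnot_opA carnot_opVx carnot_op0x. Qed.

Lemma opVK x y : op x (op (inv x) y) = y.
Proof. by rewrite carnot_opA carnot_opxV carnot_op0x. Qed.

Lemma cube_translate_inv_ex x : Zn_subgroup G ->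
  exists k, forall l, cube (op (inv (int_rV l)) x) <-> l = k.
Proof.
move=> hZ; have [m cm] := cube_translate_ex x; have [k mk] := int_rV_inv m hZ.
have km : inv (int_rV k) = int_rV m by rewrite -mk invK.
exists k => l; split=> [|->]; last by rewrite km.
have [l' ll'] := int_rV_inv l hZ; rewrite ll' => /(cube_translate_uniq cm) ml'.
by apply: int_rV_inj; rewrite -mk ml' -ll' invK.
Qed.

(** Split the integral over the translates [k o cube], then translate each piece back
    to the cube; left translations preserve Lebesgue measure. *)
Lemma ge0_integral_fold (F : borelRG -> \bar R) : Zn_subgroup G ->
  measurable_fun setT F -> (forall x, 0 <= F x)%E ->
  (\int[lebesgue_rV R n]_x F x =
   \int[lebesgue_rV R n]_(x in cube) \esum_(k in [set: 'rV[int]_n]) F (op (int_rV k) x))%E.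
Proof.
move=> hZ mF F0.
have mcube := @measurable_cube R r ns : measurable (cube : set borelRG).
have mt (x : RG) : measurable_fun setT (op x : borelRG -> borelRG).
  by apply: measurable_op; [exact: measurable_cst|exact: measurable_id].
(* [f k] is [F] restricted to the [k]-th translate of the cube. *)
pose f k (z : borelRG) : \bar R := ((\1_(cube : set borelRG) (op (inv (int_rV k)) z))%:E * F z)%E.
have f0 k z : (0 <= f k z)%E by rewrite mule_ge0// lee_fin.
have mf k : measurable_fun setT (f k).
  apply: emeasurable_funM => //; apply/measurable_EFinP.
  exact: (measurableT_comp (measurable_indic mcube) (mt _)).
transitivity (\int[lebesgue_rV R n]_x \esum_(k in [set: 'rV[int]_n]) f k x)%E.
  apply: eq_integral => x _; have [k kP] := cube_translate_inv_ex x hZ.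
  rewrite (@esum_single _ _ _ k)//.
    rewrite /f indicE mem_set ?mul1e//; exact/kP.
  move=> l lk; rewrite /f indicE memNset ?mul0e// => /kP lE.
  by rewrite lE eqxx in lk.
rewrite integral_esum// -/(cube (R := R)).
rewrite [RHS]integral_esum//; last first.
  by move=> k; apply: measurable_funTS; exact: (measurableT_comp mF (mt _)).
apply: eq_esum => k _.
rewrite -(ge0_integral_shear (mt (int_rV k)) (@shear_opl _) (mf k) (f0 k)).
rewrite [RHS]integral_mkcond; apply: eq_integral => x _.
by rewrite /f opK epatch_indic muleC.
Qed.

End lattice.

(** * The torus and its Lipschitz functions *)

Section torus_facts.
Context {R : realType} {r : nat} {hr : (1 < r)%N} {ns : 'I_r -> nat}.
Variables (G : carnotGroup R hr ns) (hZ : Zn_subgroup G).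
Local Notation n := (\sum_j ns j)%N.
Local Notation RG := 'rV[R]_n.
Local Notation op := (carnot_op G).
Local Notation inv := (carnot_inv G).
Local Notation borelRG := (borel_rV R n).
Local Notation pi := (torus_pi hZ).
Implicit Types (x y z w : RG) (k l m : 'rV[int]_n) (t : borel_torus hZ).

Lemma torus_piP x y : pi x = pi y <-> exists k, op (int_rV k) x = y.
Proof.
split=> [|[k kxy]].
  by move=> /(eqmodP (torus_equiv hZ))/asboolP.
by apply/(eqmodP (torus_equiv hZ))/asboolP; exists k.
Qed.

Lemma cube_repr_spec t : cube (cube_repr t) /\ pi (cube_repr t) = t.
Proof.
have : exists x, cube x /\ pi x = t.
  have [k kx] := cube_translate_ex G (repr t).
  exists (op (int_rV k) (repr t)); split=> //.
  rewrite -[RHS]reprK; apply/esym/torus_piP; by exists k.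
by move=> [x xt]; rewrite /cube_repr; case: xgetP => [y _ //|/(_ x)].
Qed.

Lemma cube_repr_pi x : cube x -> cube_repr (pi x : borel_torus hZ) = x.
Proof.
move=> cx; have [cr /esym/torus_piP[k kx]] := cube_repr_spec (pi x).
rewrite -kx; have int0 : int_rV 0 = 0 :> RG by apply/rowP => i; rewrite !mxE.
have -> : k = 0; last by rewrite int0 carnot_op0x.
by apply: (@cube_translate_uniq _ _ _ _ G x); rewrite ?int0 ?carnot_op0x// kx.
Qed.

Lemma closed_int_rV : closed (range (@int_rV R n)).
Proof.
suff near_z z : ~ range (@int_rV R n) z -> nbhs z (~` range (@int_rV R n)).
  by rewrite -openC openE => z nz; exact: near_z.
move=> nz; have [i zi] : exists i, forall m : int, z 0 i != m%:~R.
  apply: contrapT => H; apply: nz.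
  have H' i : exists m : int, z 0 i = m%:~R.
    apply: contrapT => H'; apply: H; exists i => m; apply/eqP => zm.
    by apply: H'; exists m.
  exists (\row_i sval (cid (H' i))) => //.
  by apply/rowP => i; rewrite !mxE; case: cid.
have nf : z 0 i \in `](Num.floor (z 0 i))%:~R, (Num.floor (z 0 i) + 1)%:~R[.
  rewrite in_itv /=; have /andP[f1 ->] := floor_itv (z 0 i).
  by rewrite lt_neqAle f1 eq_sym zi.
have cz : (x : RG) 0 i @[x --> z] --> z 0 i by exact: coord_continuous.
have near_zi : \forall x \near z, (x : RG) 0 i \in `](Num.floor (z 0 i))%:~R, (Num.floor (z 0 i) + 1)%:~R[.
  exact: cz _ (near_in_itvoo nf).
apply: filterS near_zi => w /= wi [m _ mw].
move: wi; rewrite -mw in_itv /= mxE !ltr_int ltzD1 => /andP[lt1 lt2].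
by have := lt_le_trans lt1 lt2; rewrite ltxx.
Qed.

(** The lattice acts properly: [z] is equivalent to a point of [K] iff [z o x^-1] is
    integral for some [x] in [K], and the integral points form a closed set; avoiding
    it is an open condition on [z], uniformly over the compact [K]. *)
Lemma closed_pi_compact (K : set RG) : compact K -> closed (pi @` K : set (torus hZ)).
Proof.
move=> cK; rewrite -openC.
suff near_z z : ~ (pi @` K) (pi z) -> nbhs z (pi @^-1` (~` (pi @` K))).
  suff : open (pi @^-1` (~` (pi @` K))) by [].
  by rewrite openE => z nz; exact: near_z.
move=> nz.
have cov := (compact_near_coveringP K).1 cK RG (nbhs z)
  (fun z' x => ~ range (@int_rV R n) (op z' (inv x))) (nbhs_filter z).
apply: filterS (cov _) => [z' H [x Kx /torus_piP[k kx]]|x Kx].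
  by apply: (H x Kx); exists k => //; rewrite -kx -carnot_opA carnot_opxV carnot_opx0.
have nzx : (~` range (@int_rV R n)) (op z (inv x)).
  move=> [k _ kzx]; apply: nz; exists x => //; apply/torus_piP; exists k.
  by rewrite kzx -carnot_opA carnot_opVx carnot_opx0.
have oZ : open (~` range (@int_rV R n)) by rewrite openC; exact: closed_int_rV.
have c : op p.2 (inv p.1) @[p --> (x, z)] --> op z (inv x).
  apply: op_cvg; first exact: cvg_snd.
  have /(_ x) cinv := smooth_continuous (carnot_inv_smooth G).
  by apply: (@cvg_comp _ _ _ fst inv _ (nbhs x)); [exact: cvg_fst|exact: cinv].
exact: c _ (open_nbhs_nbhs (conj oZ nzx)).
Qed.

(** The points of the half-open cube whose [i]-th coordinate is at most [a] form a
    countable union of compact boxes, so that their classes form a countable union of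
    closed sets. *)
Lemma measurable_cube_repr : measurable_fun setT (fun t => cube_repr t : borelRG).
Proof.
apply: measurable_fun_rV => i.
apply: (measurability _ (RGenOInfty.measurableE R)).
move=> _ [_ [a ->] <-]; rewrite setTI.
(* [1 - 1 / (j + 1)] exhausts the half-open interval by compact ones. *)
pose K (j : nat) : set RG :=
  [set x : RG | forall l : 'I_n, (if l == i then `[0, Num.min a (1 - j.+1%:R^-1)]
                      else `[0, 1 - j.+1%:R^-1])%classic (x ord0 l)].
have cK j : compact (K j).
  apply: (@rV_compact _ _ (fun l : 'I_n => (if l == i then `[0, Num.min a (1 - j.+1%:R^-1)]
                      else `[0, 1 - j.+1%:R^-1])%classic)) => l.
  by case: eqP => _; exact: segment_compact.
rewrite (_ : _ @^-1` _ = ~` \bigcup_j (pi @` K j : set (borel_torus hZ))).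
  apply: measurableC; apply: bigcup_measurable => j _.
  rewrite -[X in measurable X]setCK; apply: measurableC; apply: sub_sigma_algebra.
  by rewrite /= openC; exact: closed_pi_compact.
apply/seteqP; split => t /=; rewrite in_itv /= andbT; last first.
  move=> H; rewrite ltNge; apply/negP => ta; apply: H.
  have [ct pit] := cube_repr_spec t.
  have [j jP] : exists j : nat, forall l : 'I_n, cube_repr t 0 l <= 1 - j.+1%:R^-1.
    have e0 : 0 < \big[Num.min/1]_(l < n) (1 - cube_repr t 0 l).
      by apply: lt_bigmin => // l _; rewrite subr_gt0; case/andP: (ct l).
    have [j je] : exists j : nat, j.+1%:R^-1 < \big[Num.min/1]_(l < n) (1 - cube_repr t 0 l).
      near \oo%classic => j; exists j; near: j.
      exact: (near_infty_natSinv_lt (PosNum e0)).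
    exists j => l; rewrite lerBrDr -lerBrDl; apply: le_trans (ltW je) _.
    exact: bigmin_le_cond.
  exists j => //; exists (cube_repr t) => // l.
  have /andP[l0 l1] := ct l.
  by case: eqP => [li|_]; rewrite /= in_itv /= l0 ?le_min ?jP// andbT {1}li.
move=> at_ [j _ [x Kx xt]].
have cx : cube x.
  move=> l; have := Kx l; have j0 : 0 < j.+1%:R^-1 :> R by rewrite invr_gt0.
  case: eqP => _; rewrite /= in_itv /= ?le_min => /andP[-> /=]; last first.
    by move=> /le_lt_trans; apply; rewrite ltrBlDr ltrDl.
  by move=> /andP[_ /le_lt_trans]; apply; rewrite ltrBlDr ltrDl.
have := Kx i; rewrite eqxx /= in_itv /= le_min => /and3P[_ xa _].
by move: at_; rewrite -xt cube_repr_pi// ltNge xa.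
Unshelve. all: by end_near. Qed.

Lemma near_translate x (eps : R) : 0 < eps -> \forall y \near x, (d_cc G x y <= eps%:E)%E.
Proof.
move=> eps0; have c : op (inv x) y @[y --> x] --> (0 : RG).
  have : op (inv x) y @[y --> x] --> op (inv x) x.
    exact: (@op_cvg _ _ _ _ G _ _ (nbhs_filter x) (fun=> inv x) id _ _ (cvg_cst (inv x)) cvg_id).
  by rewrite carnot_opVx.
have near_x : \forall y \near x, forall z, (d_cc G z (op z (op (inv x) y)) <= eps%:E)%E.
  exact: c _ (d_cc_small G eps0).
apply: filterS near_x => y /(_ x).
by rewrite opVK.
Qed.

Section lipschitz_functions.
Variable phi : borel_torus hZ -> R.
Hypothesis phi1 : lipschitz1 phi.

Lemma lipschitz1_d_cc x y : (`|phi (pi x) - phi (pi y)|%:E <= d_cc G x y)%E.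
Proof.
apply: le_trans (phi1 _ _) _; apply: ereal_inf_lbound.
by exists (x, y).
Qed.

Lemma lipschitz1_continuous : continuous (phi \o pi : RG -> R).
Proof.
move=> x; suff : phi (pi y) @[y --> (x : RG)] --> phi (pi x) by [].
apply/(@cvgrPdist_le _ _ _ _ (nbhs_filter (x : RG))) => eps eps0; apply: (@filterS _ _ (nbhs_filter (x : RG)) _ _ _ (near_translate x eps0)) => y dxy.
by rewrite -lee_fin (le_trans (lipschitz1_d_cc x y)).
Qed.

Lemma lipschitz1_measurable : measurable_fun setT phi.
Proof.
apply: (measurability _ (RGenOpens.measurableE R)).
move=> _ [_ [a [b ->]] <-]; rewrite setTI; apply: sub_sigma_algebra => /=.
suff : open (pi @^-1` (phi @^-1` `]a, b[%classic)) by [].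
rewrite -comp_preimage; have /continuousP := lipschitz1_continuous; apply.
exact: interval_open.
Qed.

Lemma lipschitz1_bounded : exists M : R, forall t, `|phi t| <= M.
Proof.
pose K : set RG := [set x : RG | forall l : 'I_n, `[0, 1]%classic (x ord0 l)].
have cK : compact K.
  by apply: (@rV_compact _ _ (fun _ : 'I_n => `[0 : R, 1 : R]%classic)) => l; exact: segment_compact.
have K0 : K !=set0 by exists 0 => l /=; rewrite mxE in_itv /= lexx ler01.
have cphi : continuous (fun x => `|phi (pi x)|).
  by move=> x; exact: (@cvg_norm _ _ _ _ (nbhs_filter (x : RG)) _ _ (@lipschitz1_continuous x)).
have [c _ cP] := EVT_max_rV K0 cK (continuous_subspaceT cphi).
exists `|phi (pi c)| => t; have [ct <-] := cube_repr_spec t.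
apply: cP; rewrite inE => l /=; rewrite in_itv /=.
by have /andP[-> /ltW ->] := ct l.
Qed.

End lipschitz_functions.

(** The point [y] is [w o y] translated on the right by [(w o y)^-1 o y], which is
    jointly continuous in [(w, y)] and vanishes at [w = 0]; the uniformity in [y]
    comes from the relative compactness of the cube. *)
Lemma d_cc_left_translate (eps : R) : 0 < eps ->
  \forall w \near (0 : RG), forall y, cube y -> (d_cc G (op w y) y <= eps%:E)%E.
Proof.
move=> eps0; pose K : set RG := [set x : RG | forall l : 'I_n, `[0, 1]%classic (x ord0 l)].
have cK : compact K.
  by apply: (@rV_compact _ _ (fun _ : 'I_n => `[0 : R, 1 : R]%classic)) => l; exact: segment_compact.
have cov := (compact_near_coveringP K).1 cK RG (nbhs (0 : RG))
  (fun w y => (d_cc G (op w y) y <= eps%:E)%E) (nbhs_filter (0 : RG)).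
apply: filterS (cov _) => [w H y cy|y _].
  by apply: H => l /=; rewrite in_itv /=; have /andP[-> /ltW ->] := cy l.
have c : op (inv (op p.2 p.1)) p.1 @[p --> (y, (0 : RG))] --> (0 : RG).
  have /(_ (op 0 y)) cinv := smooth_continuous (carnot_inv_smooth G).
  have := @op_cvg _ _ _ _ G _ _ _ (fun p : RG * RG => inv (op p.2 p.1)) fst (inv (op 0 y)) y.
  rewrite [op 0 y]carnot_op0x carnot_opVx; apply; last exact: cvg_fst.
  rewrite -[X in inv X](carnot_op0x G); apply: (@cvg_comp _ _ _ (fun p : RG * RG => op p.2 p.1) inv _ (nbhs (op 0 y))); last exact: cinv.
  by apply: op_cvg; [exact: cvg_snd|exact: cvg_fst].
have near_y : \forall p \near (y, (0 : RG)), forall z,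
    (d_cc G z (op z (op (inv (op p.2 p.1)) p.1)) <= eps%:E)%E.
  exact: c _ (d_cc_small G eps0).
apply: filterS near_y => -[y' w] /= /(_ (op w y')).
by rewrite opVK.
Qed.

End torus_facts.

(** * The mollifier *)

Section mollifier_facts.
Context {R : realType} {r : nat} {ns : 'I_r -> nat}.
Local Notation n := (\sum_j ns j)%N.
Local Notation RG := 'rV[R]_n.
Local Notation borelRG := (borel_rV R n).
Implicit Types (x : RG) (C eps : R).

Lemma mollifier_ge0 C eps x : 0 < C -> 0 < eps -> 0 <= mollifier C eps x.
Proof.
move=> C0 eps0; rewrite /mollifier mulr_ge0//.
  by rewrite divr_ge0// ?exprn_ge0 ?ltW.
by rewrite /bump_psi; case: ifP => // _; exact: expR_ge0.
Qed.

Lemma hom_norm_ge0 x : 0 <= hom_norm x.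
Proof. exact: powR_ge0. Qed.

Lemma euclidean_norm_coord m (v : 'rV[R]_m) i : `|v 0 i| <= euclidean_norm v.
Proof.
rewrite /euclidean_norm -sqrtr_sqr ler_wsqrtr// (bigD1 i)//= lerDl.
by apply: sumr_ge0 => j _; exact: sqr_ge0.
Qed.

Lemma hom_norm_lt1 x i : hom_norm x < 1 -> `|x 0 i| < 1.
Proof.
apply: contraTT; rewrite -!leNgt => xi; have one : (1 : R) \in Num.nneg by rewrite nnegrE.
have en : 1 <= euclidean_norm (submxrow x (tagnat.sig1 i)).
  apply: le_trans xi _; apply: le_trans (euclidean_norm_coord _ (tagnat.sig2 i)).
  suff -> : submxrow x (tagnat.sig1 i) 0 (tagnat.sig2 i) = x 0 i by [].
  by rewrite mxE; congr (x _ _); exact: tagnat.sig2K.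
have pow1 (a p : R) : 0 <= p -> 1 <= a -> 1 <= a `^ p.
  move=> p0 a1; have E : (1 : R) `^ p = 1 by rewrite powR1.
  rewrite -[X in X <= _]E.
  by apply: ge0_ler_powR => //; rewrite nnegrE (le_trans ler01).
rewrite /hom_norm; apply: (pow1); first by rewrite invr_ge0 ltW.
rewrite (bigD1 (tagnat.sig1 i))//= -[X in X <= _]addr0 lerD//.
  by apply: (pow1) => //; rewrite divr_ge0// ltW.
by apply: sumr_ge0 => j _; exact: powR_ge0.
Qed.

(** For [eps <= 1] the powers [eps ^ weight] occurring in the dilation are at most
    [eps]. *)
Lemma mollifier_support C eps x : 0 < eps -> eps <= 1 -> mollifier C eps x != 0 ->
  forall i, `|x 0 i| <= eps.
Proof.
move=> eps0 eps1 mx i.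
have : hom_norm (dilation eps^-1 x) < 1.
  by move: mx; rewrite /mollifier /bump_psi; case: ifP => //; rewrite mulr0 eqxx.
move=> /(@hom_norm_lt1 _ i); rewrite dilationE normrM gtr0_norm ?exprn_gt0 ?invr_gt0//.
rewrite exprVn mulrC ltr_pdivrMr ?exprn_gt0// mul1r => /ltW/le_trans; apply.
by rewrite -[leRHS]expr1 ler_wiXn2l// ltW.
Qed.

(** Rewritten with a power of a nonnegative number, whose measurability is
    inherited from that of the power functions. *)
Lemma bump_psiE x : bump_psi x =
  if hom_norm x < 1 then expR (- ((1 - hom_norm x ^+ (2 * r`!)) `^ (-1))) else 0.
Proof.
rewrite /bump_psi; move: (hom_norm_ge0 x); move: (hom_norm x) (2 * r`!)%N => t N t0.
case: ifP => // t1; congr expR; rewrite powR_inv1; first by rewrite -invrN opprB.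
by rewrite subr_ge0 exprn_ile1// ltW.
Qed.

Lemma measurable_powR_comp d (T : measurableType d) (f : T -> R) p :
  measurable_fun setT f -> measurable_fun setT (fun t => f t `^ p).
Proof. by move=> mf; exact: (measurableT_comp (measurable_powR p) mf). Qed.

Lemma measurable_mollifier C eps :
  measurable_fun setT ((fun x => mollifier C eps x) : borelRG -> R).
Proof.
have mcoord i : measurable_fun setT (fun x : borelRG => (x : RG) 0 i : R).
  exact: measurable_coord.
pose h (x : borelRG) : R := hom_norm (dilation eps^-1 (x : RG)).
have hE : h = fun x : borelRG => (\sum_(j < r) ((\sum_(l < ns j) (eps^-1 ^+ weight (tagnat.Rank j l) *
    (x : RG) 0 (tagnat.Rank j l)) ^+ 2) `^ 2^-1) `^ ((2 * r`!)%:R / j.+1%:R))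
    `^ (2 * r`!)%:R^-1.
  apply/funext => x; rewrite /h /hom_norm; congr (_ `^ _); apply: eq_bigr => j _; congr (_ `^ _).
  rewrite /euclidean_norm powR12_sqrt; last by apply: sumr_ge0 => l _; exact: sqr_ge0.
  by congr Num.sqrt; apply: eq_bigr => l _; rewrite mxE dilationE.
have mh : measurable_fun setT h.
  rewrite hE; apply: measurable_powR_comp.
  apply: measurable_sum => j; apply: measurable_powR_comp.
  apply: measurable_powR_comp.
  apply: measurable_sum => l; apply: measurable_funX.
  by apply: measurable_funM; [exact: measurable_cst|exact: mcoord].
rewrite /mollifier; apply: measurable_funM; first exact: measurable_cst.
rewrite (_ : (fun x => _) = fun x => if h x < 1 then
    expR (- ((1 - h x ^+ (2 * r`!)) `^ (-1))) else 0); last first.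
  by apply/funext => x; rewrite bump_psiE.
apply: measurable_fun_ifT; last exact: measurable_cst.
  by apply: measurable_fun_ltr => //; exact: measurable_cst.
apply: (@measurableT_comp _ _ _ _ _ _ expR setT); first exact: measurable_expR.
apply: measurable_funN.
apply: measurable_powR_comp; apply: measurable_funB.
  exact: measurable_cst.
exact: measurable_funX.
Qed.

End mollifier_facts.

(** * Mollified measures as laws *)

Section measures.
Local Open Scope ereal_scope.
Context d (T : measurableType d) (R : realType).

Lemma ge0_integral_mrestr (mu : {measure set T -> \bar R}) (D E : set T)
    (mD : measurable D) (f : T -> \bar R) :
  measurable E -> measurable_fun setT f -> (forall x, 0 <= f x) ->
  \int[mrestr mu mD]_(x in E) f x = \int[mu]_(x in E `&` D) f x.
Proof.
move=> mE mf f0; have mEf : measurable_fun E f by exact: measurable_funTS.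
have mDC : measurable (~` D) by exact: measurableC.
have muDC : mrestr mu mD (~` D) = 0 by rewrite /mrestr setICl measure0.
rewrite (ge0_negligible_integral mDC mE mEf (fun x _ => f0 x) muDC).
rewrite setDE setCK; apply: eq_measure_integral => A mA AED.
by rewrite /= /mrestr; congr (mu _); apply/setIidPl => x /AED[].
Qed.

Lemma density_probability (mu : {measure set T -> \bar R}) (f : T -> \bar R) :
  measurable_fun setT f -> (forall x, 0 <= f x) -> \int[mu]_x f x = 1 ->
  exists P : probability T R, forall A, measurable A -> P A = \int[mu]_(x in A) f x.
Proof.
move=> mf f0 f1; pose m (A : set T) := \int[mu]_(x in A) f x.
have m0 : m set0 = 0 by rewrite /m integral_set0.
have m_ge0 A : 0 <= m A by exact: integral_ge0.
have m_sigma : semi_sigma_additive m.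
  move=> /= F mF tF mUF; rewrite /m; apply: cvg_toP.
    apply: ereal_nondecreasing_is_cvgn => i j ij.
    by apply: lee_sum_nneg_natr => // k _ _; exact: integral_ge0.
  by rewrite ge0_integral_bigcup//; exact: measurable_funTS.
pose mM := isMeasure.Build _ _ _ m m0 m_ge0 m_sigma.
pose M : {measure set T -> \bar R} := HB.pack m mM.
have M1 : M setT = 1 by [].
pose MP := Measure_isProbability.Build _ _ _ (M : set T -> \bar R) M1.
pose P : probability T R := HB.pack m mM MP.
by exists P.
Qed.

End measures.

Section smoothing.
Local Open Scope ereal_scope.
Context {R : realType} {r : nat} {hr : (1 < r)%N} {ns : 'I_r -> nat}.
Variables (G : carnotGroup R hr ns) (hZ : Zn_subgroup G).
Local Notation n := (\sum_j ns j)%N.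
Local Notation RG := 'rV[R]_n.
Local Notation op := (carnot_op G).
Local Notation inv := (carnot_inv G).
Local Notation borelRG := (borel_rV R n).
Local Notation leb := (lebesgue_rV R n).
Local Notation pi := (torus_pi hZ).
Implicit Types (x y z w : RG) (k : 'rV[int]_n) (t s : borel_torus hZ).

Lemma pushforward_probability d d' (T : measurableType d) (T' : measurableType d')
    (P : probability T R) (f : T -> T') : measurable_fun setT f ->
  exists Q : probability T' R, forall A, Q A = P (f @^-1` A).
Proof.
move=> mf; pose fM := isMeasurableFun.Build _ _ _ _ _ mf.
pose X : {RV P >-> T'} := HB.pack f fM.
by exists (distribution P X).
Qed.

Variables (psi : RG -> R).
Hypothesis psi_ge0 : forall x, (0 <= psi x)%R.
Hypothesis mpsi : measurable_fun setT (psi : borelRG -> R).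

Definition periodized x y : \bar R :=
  \esum_(k in [set: 'rV[int]_n]) (psi (op (op (int_rV k) x) (inv y)))%:E.

Lemma periodized_ge0 x y : 0 <= periodized x y.
Proof. by apply: esum_ge0 => k _; rewrite lee_fin. Qed.

Lemma measurable_periodized d (T : measurableType d) (f g : T -> borelRG) :
  measurable_fun setT f -> measurable_fun setT g ->
  measurable_fun setT (fun u => periodized (f u) (g u)).
Proof.
move=> mf mg; apply: measurable_esum => [k u|k]; first by rewrite lee_fin.
apply/measurable_EFinP.
apply: (@measurableT_comp _ _ _ _ _ _ (psi : borelRG -> R) setT) => //.
by apply: measurable_op; [apply: measurable_op => //; exact: measurable_cst|exact: measurable_inv].
Qed.

(** The class of [w o y], where [p] consists of the class of [y] and of [w]. *)
Definition translated_class (p : borel_torus hZ * borelRG) : borel_torus hZ :=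
  pi (op p.2 (cube_repr p.1)).

Lemma measurable_translated_class : measurable_fun setT translated_class.
Proof.
apply: (measurableT_comp (@measurable_torus_pi _ _ _ _ G hZ)).
apply: measurable_op; first exact: measurable_snd.
exact: (measurableT_comp (@measurable_cube_repr _ _ _ _ G hZ) measurable_fst).
Qed.

Variable mu : probability (borel_torus hZ) R.
Variable P : probability borelRG R.
Hypothesis PE : forall A, measurable A -> P A = \int[leb]_(w in A) (psi w)%:E.

(** For a fixed class [s], represented by [y] in the cube, the density of [w o y] is
    [psi (x o y^-1)] since right translations preserve Lebesgue measure.  Folding it
    over the lattice gives the density of its class; then average over [s]. *)
Lemma smoothing_density (A : set (borel_torus hZ)) : measurable A ->
  (mu \x P) (translated_class @^-1` A) =
  \int[lebesgue_torus hZ]_(t in A) \int[mu]_s periodized (cube_repr t) (cube_repr s).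
Proof.
move=> mA.
have mcube := @measurable_cube R r ns : measurable (cube : set borelRG).
have mpi := @measurable_torus_pi _ _ _ _ G hZ.
have mrep := @measurable_cube_repr _ _ _ _ G hZ.
have mpiA : measurable (pi @^-1` A : set borelRG).
  by rewrite -[X in measurable X]setTI; exact: mpi.
have mpre : measurable (translated_class @^-1` A).
  by rewrite -[X in measurable X]setTI; exact: measurable_translated_class.
pose H (p : borelRG * borel_torus hZ) : \bar R :=
  (\1_(pi @^-1` A `&` cube : set borelRG) p.1)%:E * periodized p.1 (cube_repr p.2).
have H0 p : 0 <= H p by rewrite mule_ge0 ?lee_fin// periodized_ge0.
have mH : measurable_fun setT H.
  apply: emeasurable_funM.
    apply/measurable_EFinP.
    exact: (measurableT_comp (measurable_indic (measurableI _ _ mpiA mcube)) measurable_fst).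
  apply: measurable_periodized; first exact: measurable_fst.
  exact: (measurableT_comp mrep measurable_snd).
(* [H (x, s)] is the density at [x] in the cube of the representative of the class
   of [w o cube_repr s], restricted to [A]. *)
transitivity (\int[mu]_s \int[leb]_x H (x, s)).
  apply: eq_integral => s _; set y := cube_repr s.
  have my : measurable_fun setT (op^~ y : borelRG -> borelRG).
    by apply: measurable_op; [exact: measurable_id|exact: measurable_cst].
  have my' : measurable_fun setT (op^~ (inv y) : borelRG -> borelRG).
    by apply: measurable_op; [exact: measurable_id|exact: measurable_cst].
  have mx : measurable (xsection (translated_class @^-1` A) s) by exact: measurable_xsection.
  rewrite [LHS](PE mx).
  pose f (z : borelRG) : \bar R := (\1_(pi @^-1` A : set borelRG) z)%:E * (psi (op z (inv y)))%:E.
  have f0 z : 0 <= f z by rewrite mule_ge0 ?lee_fin.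
  have mf : measurable_fun setT f.
    apply: emeasurable_funM; apply/measurable_EFinP; first exact: measurable_indic.
    exact: (measurableT_comp mpsi my').
  transitivity (\int[leb]_w f (op w y)).
    rewrite integral_mkcond; apply: eq_integral => w _.
    rewrite /f -carnot_opA carnot_opxV carnot_opx0 patchE indicE mem_xsection.
    rewrite (_ : ((s, w) \in translated_class @^-1` A) = (op w y \in pi @^-1` A)).
      by case: ifP => _; rewrite ?mul1e ?mul0e.
    by apply/idP/idP; rewrite !inE.
  rewrite (ge0_integral_shear my (@shear_opr _ _ _ _ G y) mf f0).
  rewrite (ge0_integral_fold hZ mf f0) integral_mkcond.
  apply: eq_integral => x _; rewrite patchE /H /f /= indicE in_setI.
  have piE k : pi (op (int_rV k) x) = pi x by apply/esym/torus_piP; exists k.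
  have AE k : (op (int_rV k) x \in pi @^-1` A) = (x \in pi @^-1` A).
    by apply/idP/idP; rewrite !inE /= piE.
  case: (boolP (x \in cube)) => _; last by rewrite andbF mul0e.
  rewrite andbT; case: (boolP (x \in pi @^-1` A)) => xA.
    by rewrite mul1e; apply: eq_esum => k _; rewrite indicE AE xA mul1e.
  by rewrite mul0e esum1// => k _; rewrite indicE AE (negbTE xA) mul0e.
rewrite -(fubini_tonelli H mH H0).
pose K (t : borel_torus hZ) := \int[mu]_s periodized (cube_repr t) (cube_repr s).
have K0 t : 0 <= K t by apply: integral_ge0 => s _; exact: periodized_ge0.
have mK : measurable_fun setT K.
  pose q (p : borel_torus hZ * borel_torus hZ) := periodized (cube_repr p.1) (cube_repr p.2).
  apply: (@measurable_fun_fubini_tonelli_F _ _ _ _ _ mu q).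
    apply: measurable_periodized; [exact: (measurableT_comp mrep measurable_fst)|].
    exact: (measurableT_comp mrep measurable_snd).
  by move=> p; exact: periodized_ge0.
have mKpi : measurable_fun setT (K \o pi : borelRG -> \bar R) by exact: measurableT_comp mK mpi.
transitivity (\int[mrestr leb (@measurable_cube R r ns)]_(x in pi @^-1` A) (K \o pi) x); last first.
  rewrite -(ge0_integral_pushforward mpi _ mA (measurable_funTS mK))//.
rewrite [RHS](ge0_integral_mrestr _ (@measurable_cube R r ns) mpiA mKpi (fun x => K0 (pi x))).
rewrite [RHS]integral_mkcond; apply: eq_integral => x _.
rewrite patchE; case: (boolP (x \in _)) => xA.
  have cx : cube x by move: xA; rewrite inE => -[].
  transitivity (\int[mu]_s periodized x (cube_repr s)).
    by apply: eq_integral => s _; rewrite /H /= indicE xA mul1e.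
  by rewrite -[in LHS](cube_repr_pi hZ cx).
by apply: integral0_eq => s _; rewrite /H /= indicE (negbTE xA) mul0e.
Qed.

End smoothing.

(** * Couplings and the Kantorovich-Rubinstein distance *)

Section coupling.
Local Open Scope ereal_scope.
Context {R : realType} {r : nat} {hr : (1 < r)%N} {ns : 'I_r -> nat}.
Variables (G : carnotGroup R hr ns) (hZ : Zn_subgroup G).
Implicit Types (m : probability (borel_torus hZ) R).

Lemma d_cc_ge0 x y : 0 <= d_cc G x y.
Proof. by apply: le_ereal_inf_tmp => _ [delta [delta0 _] <-]; rewrite lee_fin ltW. Qed.

Lemma d_cc_torus_ge0 (s t : torus hZ) : 0 <= d_cc_torus s t.
Proof. by apply: le_ereal_inf_tmp => _ [xy _ <-]; exact: d_cc_ge0. Qed.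

Lemma KR_dist_ge0 m m' : 0 <= KR_dist m m'.
Proof.
apply: ereal_sup_ubound; exists (fun=> 0%R).
  by move=> s t; rewrite subrr normr0; exact: d_cc_torus_ge0.
by rewrite !integral0 subee.
Qed.

Context d (X : measurableType d) (P : probability X R).

Lemma bounded_integrable (phi : X -> R) (M : R) :
  measurable_fun setT phi -> (forall x, (`|phi x| <= M)%R) ->
  P.-integrable setT (EFin \o phi).
Proof.
move=> mphi phiM; apply: measurable_bounded_integrable => //.
  by rewrite (le_lt_trans (probability_le1 _ _))// ltry.
exists M; split; first exact: num_real.
by move=> x Mx y _; exact: le_trans (phiM y) (ltW Mx).
Qed.

Lemma integral_law d' (Y : measurableType d') (m : probability Y R) (f : X -> Y) (phi : Y -> R)
    (M : R) : measurable_fun setT f -> measurable_fun setT phi ->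
  (forall y, (`|phi y| <= M)%R) -> (forall B, measurable B -> m B = P (f @^-1` B)) ->
  \int[m]_y (phi y)%:E = \int[P]_x (phi (f x))%:E.
Proof.
move=> mf mphi phiM mE; transitivity (\int[pushforward P f]_y (phi y)%:E).
  by apply: eq_measure_integral => B mB _; exact: mE.
rewrite integral_pushforward//; first exact/measurable_EFinP.
rewrite preimage_setT; apply: (@bounded_integrable (phi \o f) M) => //.
  exact: measurableT_comp.
by move=> x; exact: phiM.
Qed.

(** [f] and [g] couple [m] and [m'] on the probability space [P]; for a 1-Lipschitz
    [phi] the difference of the integrals is the mean of [phi (f p) - phi (g p)]. *)
Lemma KR_dist_coupling m m' (f g : X -> borel_torus hZ) (N : set X) (eta : R) :
  measurable_fun setT f -> measurable_fun setT g ->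
  (forall B, measurable B -> m B = P (f @^-1` B)) ->
  (forall B, measurable B -> m' B = P (g @^-1` B)) ->
  measurable N -> P N = 0 ->
  (forall p, ~ N p -> d_cc_torus (f p : torus hZ) (g p) <= eta%:E) ->
  KR_dist m m' <= eta%:E.
Proof.
move=> mf mg mE m'E mN PN fg; apply: ge_ereal_sup => _ [phi phi1 <-].
have mphi := lipschitz1_measurable phi1; have [M phiM] := lipschitz1_bounded phi1.
rewrite (integral_law mf mphi phiM mE) (integral_law mg mphi phiM m'E).
have If : P.-integrable setT (EFin \o (phi \o f)).
  by apply: (@bounded_integrable _ M); [exact: measurableT_comp|move=> x; exact: phiM].
have Ig : P.-integrable setT (EFin \o (phi \o g)).
  by apply: (@bounded_integrable _ M); [exact: measurableT_comp|move=> x; exact: phiM].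
rewrite -(integralB_EFin measurableT If Ig) (negligible_integral mN)//; last first.
  exact: (integrableB measurableT If Ig).
rewrite setTD; have mNC : measurable (~` N) by exact: measurableC.
have PNC : P (~` N) = 1 by rewrite probability_setC// PN sube0.
apply: (@le_trans _ _ (\int[P]_(x in ~` N) cst eta%:E x)); last first.
  by rewrite (integral_cst _ mNC) [X in _ * X]PNC mule1.
apply: le_integral => //.
- exact: (integrableS measurableT mNC _ (integrableB measurableT If Ig)).
- apply: (integrableS measurableT mNC) => //.
  by apply: (@bounded_integrable (fun=> eta) `|eta|%R).
- move=> p; rewrite inE => Np /=; rewrite -EFinB; apply: le_trans (fg p Np).
  apply: le_trans (phi1 _ _); rewrite lee_fin; exact: ler_norm.
Qed.

End coupling.

(** * Convergence of the mollified measures *)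

Section approximation.
Context {R : realType} {r : nat} {hr : (1 < r)%N} {ns : 'I_r -> nat}.
Variables (G : carnotGroup R hr ns) (hZ : Zn_subgroup G).
Local Notation n := (\sum_j ns j)%N.
Local Notation RG := 'rV[R]_n.
Local Notation borelRG := (borel_rV R n).
Variables (C : R) (mu : probability (borel_torus hZ) R).
Hypothesis C0 : 0 < C.
Hypothesis C1 : forall eps : R, 0 < eps ->
  (\int[lebesgue_rV R n]_x (mollifier C eps x)%:E = 1)%E.

Definition box (eps : R) : set borelRG := [set x | forall i, `|(x : RG) 0 i| <= eps].

Lemma measurable_box eps : measurable (box eps).
Proof.
rewrite (_ : box eps = \bigcap_(i in [set: 'I_n])
    ((fun x : borelRG => (x : RG) 0 i : R) @^-1` `[- eps, eps])).
  apply: fin_bigcap_measurable => // i _; rewrite -[X in measurable X]setTI.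
  exact: measurable_coord.
apply/seteqP; split => [x cx i _|x cx i].
  by rewrite /= in_itv /= -ler_norml; exact: cx.
by have := cx i I; rewrite /= in_itv /= -ler_norml.
Qed.

(** The two facts about [mu_eps] which are used at a single scale.  The premise
    [eps <= 1] makes the box contain the support of the mollifier. *)
Definition is_mollification (eps : R) (Q : probability (borel_torus hZ) R) :=
  (forall A, measurable A ->
    Q A = (\int[lebesgue_torus hZ]_(x in A) mollified_density C eps mu x)%E) /\
  (forall eta : R, eps <= 1 ->
    (forall w, box eps w -> forall y, cube y -> (d_cc G (carnot_op G w y) y <= eta%:E)%E) ->
    (KR_dist Q mu <= eta%:E)%E).

(** The measure is the law of the class of [w o y], coupled with that of [y]; the
    event that [w] lies outside the box is null. *)
Lemma mollified_probability eps : 0 < eps -> exists Q : probability (borel_torus hZ) R,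
  is_mollification eps Q.
Proof.
move=> eps0.
pose psi : RG -> R := mollifier C eps.
have psi0 x : 0 <= psi x by exact: mollifier_ge0.
have mpsi : measurable_fun setT (psi : borelRG -> R) by exact: measurable_mollifier.
have [P PE] := @density_probability _ _ R (lebesgue_rV R n) (fun x => (psi x)%:E)
  ((measurable_EFinP _ _).2 mpsi) (fun x => psi0 x) (C1 eps0).
have mtc := @measurable_translated_class _ _ _ _ G hZ.
have [Q QE] := pushforward_probability (mu \x P)%E mtc.
exists Q; split=> [A mA|eta eps1 small].
  by rewrite QE; exact: (smoothing_density psi0 mpsi mu PE mA).
have mbox := measurable_box eps.
have PN : P (~` box eps) = 0%E.
  rewrite PE; last exact: measurableC.
  apply: integral0_eq => w wN; congr (_%:E); apply/eqP/negPn/negP => psiw.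
  exact: wN (mollifier_support eps0 eps1 psiw).
have fstE B : measurable B -> mu B = (mu \x P)%E (fst @^-1` B).
  move=> mB; have -> : fst @^-1` B = B `*` [set: borelRG] :> set (borel_torus hZ * borelRG).
    by apply/seteqP; split=> [[s w] /=|[s w] []].
  rewrite [RHS](product_measure1E mu P mB measurableT).
  by rewrite [X in (_ * X)%E](probability_setT P) mule1.
apply: (KR_dist_coupling (N := setT `*` ~` box eps) mtc measurable_fst (fun B _ => QE B) fstE).
- exact: measurableX measurableT (measurableC mbox).
- rewrite [LHS](product_measure1E mu P measurableT (measurableC mbox)).
  by rewrite [X in (_ * X)%E]PN mule0.
- move=> [s w] /= sw; have bw : box eps w by apply: contrapT => bw; apply: sw.
  have [cs ps] := cube_repr_spec s.
  apply: le_trans (small w bw _ cs); apply: ereal_inf_lbound.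
  by exists (carnot_op G w (cube_repr s), cube_repr s).
Qed.

Lemma near_small_box (eta : R) : 0 < eta -> \forall eps \near (0 : R)^'+,
  forall w, box eps w -> forall y, cube y -> (d_cc G (carnot_op G w y) y <= eta%:E)%E.
Proof.
move=> eta0; have := d_cc_left_translate G eta0 => /nbhs_ballP[e /= e0 eP].
near=> eps => w bw; apply: eP; split=> // i j.
have eps_lt : eps < e by near: eps; exact: nbhs_right_lt.
suff : ball (0 : R) e (w i j) by rewrite mxE.
rewrite -ball_normE /= sub0r normrN (ord1 i).
exact: le_lt_trans (bw j) eps_lt.
Unshelve. all: by end_near. Qed.

End approximation.

Theorem corollary1p1 (R : realType) (r : nat) (hr : (1 < r)%N)
    (ns : 'I_r -> nat) (G : carnotGroup R hr ns) (hZ : Zn_subgroup G)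
    (C : R) (hC : 0 < C)
    (hC1 : forall eps : R, 0 < eps ->
      (\int[lebesgue_rV R (\sum_j ns j)]_x (mollifier C eps x)%:E = 1)%E)
    (mu : probability (borel_torus hZ) R) :
  exists mu_ : R -> probability (borel_torus hZ) R,
    (forall eps : R, 0 < eps ->
      forall A : set (borel_torus hZ), measurable A ->
        mu_ eps A = (\int[lebesgue_torus hZ]_(x in A) mollified_density C eps mu x)%E) /\
    KR_dist (mu_ eps) mu @[eps --> 0^'+] --> 0%E.
Proof.
have /choice[mu_ mu_P] : forall eps : R, exists Q : probability (borel_torus hZ) R,
    0 < eps -> is_mollification C mu eps Q.
  move=> eps; have [eps0|] := pselect (0 < eps); last by exists mu.
  by have [Q QP] := mollified_probability mu hC hC1 eps0; exists Q.
exists mu_; split=> [eps eps0 A mA|]; first exact: (mu_P eps eps0).1.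
have small (eta : R) : 0 < eta -> \forall eps \near (0 : R)^'+,
    (0 <= KR_dist (mu_ eps) mu <= eta%:E)%E.
  move=> eta0; near=> eps; rewrite KR_dist_ge0 /=.
  have eps0 : 0 < eps by near: eps; exact: nbhs_right_gt.
  apply: (mu_P eps eps0).2; first by near: eps; exact: nbhs_right_le.
  by near: eps; exact: near_small_box.
apply/(@fine_cvgP _ _ (0 : R)^'+); split.
  have := small 1 ltr01; apply: filterS => eps /andP[d0 d1].
  by rewrite fin_numElt (lt_le_trans _ d0)// (le_lt_trans d1)// ltry.
apply/cvgrPdist_le => eta eta0; have := small eta eta0; apply: filterS => eps /andP[d0 d1].
have df : KR_dist (mu_ eps) mu \is a fin_num.
  by rewrite fin_numElt (lt_le_trans _ d0)// (le_lt_trans d1)// ltry.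
by rewrite /= sub0r normrN ger0_norm ?fine_ge0// -lee_fin fineK.
Unshelve. all: by end_near. Qed.
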